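(* The system \begin{align*} w_t(x,t)&=w_{xx}(x,t)-\rho w(x,t)+\alpha v(x,t),\\ 0&=v_{xx}(x,t)-\gamma v(x,t)+\beta w(x,t),\\ w_x(0,t)&=0,\quad w_x(1,t)=u(t),\quad v_x(0,t)=0,\quad v_x(1,t)=0, \end{align*} ($x\in[0,1]$, $t\ge0$) is exponentially stable if the control signal is $$u(t)=\int_0^1k^a_x(1,y)w(y,t)\,dy+k^a(1,1)w(1,t),\qquad k^a(x,y)=-c_2x\frac{I_1\left(\sqrt{c_2(x^2-y^2)}\right)}{\sqrt{c_2(x^2-y^2)}},$$ and the parameter $c_2$ satisfies $$c_2+\rho>\frac{|\alpha\beta|}{\gamma}\left[1+\sqrt{\frac{c_2\pi}{8}}\left(\mathrm{erfi}\left(\sqrt{\tfrac{c_2}{2}}\right)\right)^{1/2}\left(\mathrm{erf}\left(\sqrt{\tfrac{c_2}{2}}\right)\right)^{1/2}\right]^2.$$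
   Context: The parameters $\rho,\alpha,\beta,\gamma$ are real with $\alpha,\beta$ nonzero, $\gamma\neq-(n\pi)^2$ for $n=0,1,2,\dots$, and $c_2>0$. $I_1(x)=\sum_{m\ge0}\frac{(x/2)^{2m+1}}{m!(m+1)!}$ is the modified Bessel function of first order; the value of $k^a$ at $y=x$ is taken by continuity, so $k^a(x,x)=-\frac12c_2x$, and $k^a_x$ is the partial derivative in the first variable. $\mathrm{erfi}(x)=\frac{2}{\sqrt\pi}\int_0^xe^{\xi^2}d\xi$, $\mathrm{erf}(x)=\frac{2}{\sqrt\pi}\int_0^xe^{-\xi^2}d\xi$. The state is $w(\cdot,t)\in L^2(0,1)$, with $v(\cdot,t)$ determined by the elliptic equation. Exponentially stable means there are $M\ge1$, $\omega>0$ with $\|w(\cdot,t)\|+\|v(\cdot,t)\|\le Me^{-\omega t}\|w(\cdot,0)\|$ ($L^2(0,1)$ norms) for all $t\ge0$ and all initial data in $L^2(0,1)$.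
   Formalization: The formal statement additionally assumes γ>0: for γ<0 the condition's right-hand side is negative and the claim fails, e.g. ρ=0, α=1, β=−1, γ=−1 with small c₂>0, where an unstable eigenvalue near 1 persists. *)

(* Defs.v *)
From HB Require Import structures.
From mathcomp Require Import all_boot all_order all_algebra.
From mathcomp Require Import all_classical all_reals all_analysis.

Set Implicit Arguments.
Unset Strict Implicit.
Unset Printing Implicit Defensive.

Import Order.TTheory GRing.Theory Num.Theory.
Import numFieldNormedType.Exports.

Local Open Scope classical_set_scope.
Local Open Scope ring_scope.

(* Functions on the interval are total functions [R -> R]; every notion below
   only looks at their values on [0, 1]. *)
Definition I01 {R : realType} : set R := `[0, 1].

Section SpecialFunctions.
Context {R : realType}.
Local Notation mu := (@lebesgue_measure R).

(* The integrals below run over the set [`[0, x]], so these are the usual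
   functions for x >= 0 only. *)
Definition erf (x : R) : R :=
  2 / Num.sqrt pi * \int[mu]_(xi in `[0, x]) expR (- xi ^+ 2).

Definition erfi (x : R) : R :=
  2 / Num.sqrt pi * \int[mu]_(xi in `[0, x]) expR (xi ^+ 2).

Definition besselI1 (x : R) : R :=
  limn (series (fun m : nat =>
    (x / 2) ^+ (2 * m).+1 / ((m`!)%:R * ((m.+1)`!)%:R) : R)).

(* Meant for 0 <= y <= x. *)
Definition ka (c2 x y : R) : R :=
  if x == y then - (1 / 2) * c2 * x
  else - c2 * x * (besselI1 (Num.sqrt (c2 * (x ^+ 2 - y ^+ 2)))
                   / Num.sqrt (c2 * (x ^+ 2 - y ^+ 2))).

(* Used for y < x; at y = x the two-sided derivative would involve points
   outside the domain of ka, but that is a single point y when integrating. *)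
Definition ka_x (c2 x y : R) : R := derive1 (fun z => ka c2 z y) x.

End SpecialFunctions.

Section FunctionSpaces.
Context {R : realType}.
Local Notation mu := (@lebesgue_measure R).
Implicit Types f g : R -> R.

Definition L2 f : Prop := (f \_ I01) \in Lfun mu 2%:E.

Definition l2norm f : R := fine 'N[mu]_2%:E[EFin \o (f \_ I01)].

(* f is (the continuously differentiable representative of) an element of
   H^2(0,1), with derivative fx and weak second derivative fxx: f and fx are
   absolutely continuous, with a.e. derivatives fx and fxx, and fxx is in L^2.
   In particular fx 0 and fx 1 are the boundary values of f'. *)
Definition H2 f fx fxx : Prop :=
  [/\ L2 fxx,
      forall x, I01 x -> fx x = fx 0 + \int[mu]_(y in `[0, x]) fxx y &
      forall x, I01 x -> f x = f 0 + \int[mu]_(y in `[0, x]) fx y].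

(* A function of (x, t) is represented by z : R -> R -> R with the time
   argument first, so that z t is the profile z(., t). *)
Definition L2_continuous_at (z : R -> R -> R) (t : R) : Prop :=
  (fun s => l2norm (fun x => z s x - z t x))
    @ within [set s | 0 <= s] (nbhs t) --> (0 : R).

Definition L2_derivative_at (z : R -> R -> R) (t : R) (zt : R -> R) : Prop :=
  L2 zt /\
  (fun h => l2norm (fun x => (z (t + h) x - z t x) / h - zt x))
    @ 0^' --> (0 : R).

End FunctionSpaces.

Section System.
Context {R : realType}.
Local Notation mu := (@lebesgue_measure R).

(* Solutions for initial data w(., 0) that are merely in L^2: t |-> w(., t) is
   continuous into L^2(0,1) on [0, +oo[ and, as is natural for a parabolic
   equation, it is L^2-differentiable with values in H^2(0,1) for t > 0, where
   the evolution equation and the boundary conditions on w hold.  The elliptic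
   problem for v makes sense, and is imposed, also at t = 0.  The control value
   u t is thus only used for t > 0. *)
Definition is_solution (rho alpha beta gamma : R) (u : R -> R)
    (w v : R -> R -> R) : Prop :=
  [/\ forall t, 0 <= t -> L2 (w t),
      forall t, 0 <= t -> L2_continuous_at w t,
      forall t, 0 < t -> exists wt wx wxx : R -> R,
        [/\ L2_derivative_at w t wt,
            H2 (w t) wx wxx,
            wt = (fun x => wxx x - rho * w t x + alpha * v t x)
              %[ae mu in I01],
            wx 0 = 0 &
            wx 1 = u t] &
      forall t, 0 <= t -> exists vx vxx : R -> R,
        [/\ H2 (v t) vx vxx,
            (fun=> 0) = (fun x => vxx x - gamma * v t x + beta * w t x)
              %[ae mu in I01],
            vx 0 = 0 &
            vx 1 = 0]].

Definition control (c2 : R) (w : R -> R -> R) (t : R) : R :=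
  \int[mu]_(y in I01) (ka_x c2 1 y * w t y) + ka c2 1 1 * w t 1.

(* M and omega are uniform over all trajectories, hence over all initial data
   w 0 in L^2(0,1). *)
Definition exponentially_stable
    (trajectory : (R -> R -> R) -> (R -> R -> R) -> Prop) : Prop :=
  exists M omega : R,
    [/\ 1 <= M, 0 < omega &
        forall w v : R -> R -> R, trajectory w v ->
        forall t : R, 0 <= t ->
          l2norm (w t) + l2norm (v t) <= M * expR (- omega * t) * l2norm (w 0)].

End System.

(* Main.v *)
Require Import Defs.
From mathcomp Require Import all_boot all_order all_algebra.
From mathcomp Require Import all_classical all_reals all_analysis.
From mathcomp Require Import measurable_realfun ring lra.
Import Order.TTheory GRing.Theory Num.Theory.
Import numFieldNormedType.Exports.
Local Open Scope classical_set_scope.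
Local Open Scope ring_scope.

(** Write (S f)(x) = x * int_0^x f and tau = c2 / 2.  By induction
    S^(m+1) f (x) = x / (2^m m!) * int_0^x (x^2 - y^2)^m f(y) dy, and summing
    tau^n / n! * S^n reproduces the Bessel series of the kernel: the
    backstepping transformation w |-> w - int_0^x k^a(x,y) w(y) dy is the
    exponential T = exp (tau S).  On functions with f'(0) = 0 one has
    D^2 S = S D^2 + 2, hence D^2 T = T D^2 + 2 tau T: this replaces the
    differential equation of the kernel, and exp (- tau S) is the inverse
    transformation.  Therefore T w solves the heat equation with reaction
    coefficient c2 + rho and source alpha T v, with f'(0) = 0 inherited from w,
    while the feedback law says exactly that (T w)'(1) = 0.

    Only the truncations T_N of the exponential series are used ([expgen]).
    They are finite sums, so that every identity above becomes an identity with
    an explicit remainder (the term of order N, a tail of the series of the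
    gain, the defect of the product exp (- tau S) exp (tau S)), and these
    remainders tend to 0 relatively to the norm of w.  As the stability
    condition is strict, one large N is enough ([small_truncation]).

    The constants come from three bounds.
    - The representation of S^(m+1) gives
      |T f - f| (x) <= tau int_0^x exp (tau (x^2 - y^2) / 2) |f(y)| dy, for both
      signs of tau; by Cauchy-Schwarz T and its inverse have norm at most
      1 + [hsbound tau], and [hsbound (c2 / 2)] is the product of square roots
      in the stability condition ([hsboundE]).
    - Testing the elliptic equation with v gives |v| <= |beta| / gamma |w|
      ([elliptic_bound]).
    - Testing the equation of T w with T w gives
      d/dt |T w|^2 / 2 <= - (c2 + rho) |T w|^2 + |alpha| |T w| |T v| up to the
      remainders ([parabolic_energy]), and |T v| is at most
      (1 + hsbound)^2 |beta| / gamma |T w|.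
    So |T w|^2 decays exponentially ([energy_decay]), and with it w and v. *)

Set Implicit Arguments.
Unset Strict Implicit.
Unset Printing Implicit Defensive.

(** * Integration on the unit interval *)

Section Integration.
Context {R : realType}.
Local Notation mu := (@lebesgue_measure R).
Local Notation D := (@I01 R).
Implicit Types f g h : R -> R.

Definition L1 f : Prop := mu.-integrable D (EFin \o f).

Definition primitive f (x : R) : R := \int[mu]_(y in `[0, x]) f y.

Definition ip f g : R := \int[mu]_(x in D) (f x * g x).

Lemma I01P x : D x <-> 0 <= x <= 1.
Proof. by rewrite /I01 /= in_itv. Qed.

Lemma measurable_I01 : measurable (D : set (measurableTypeR R)).
Proof. exact: measurable_itv. Qed.
Hint Resolve measurable_I01 : core.

Lemma I01_0 : D 0. Proof. by apply/I01P; rewrite lexx ler01. Qed.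
Lemma I01_1 : D 1. Proof. by apply/I01P; rewrite lexx ler01. Qed.

Lemma subset_I01 x : D x -> `[0, x] `<=` D.
Proof.
move=> /I01P /andP[x0 x1] y /=; rewrite in_itv /= => /andP[y0 yx].
by apply/I01P; rewrite y0 (le_trans yx).
Qed.

Lemma L1_sub f x : D x -> L1 f -> mu.-integrable `[0, x] (EFin \o f).
Proof. by move=> Dx; apply: integrableS => //; exact: subset_I01. Qed.

Lemma eq_L1 f g : (forall x, D x -> f x = g x) -> L1 f -> L1 g.
Proof.
move=> fg; apply: eq_integrable => // x /set_mem Dx.
by rewrite /= fg.
Qed.

Lemma L1D f g : L1 f -> L1 g -> L1 (fun x => f x + g x).
Proof. by move=> Lf Lg; have := integrableD measurable_I01 Lf Lg; exact: eq_integrable. Qed.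

Lemma L1Z r f : L1 f -> L1 (fun x => r * f x).
Proof. by move=> Lf; have := integrableZl measurable_I01 r Lf; exact: eq_integrable. Qed.

Lemma L1B f g : L1 f -> L1 g -> L1 (fun x => f x - g x).
Proof. by move=> Lf Lg; have := integrableB measurable_I01 Lf Lg; exact: eq_integrable. Qed.

Lemma L1_norm f : L1 f -> L1 (fun x => `|f x|).
Proof. exact: integrable_norm. Qed.

Lemma L1_cont f : {within D, continuous f} -> L1 f.
Proof. by move=> cf; apply: continuous_compact_integrable => //; exact: segment_compact. Qed.

Lemma L1_cst r : L1 (fun=> r).
Proof. by apply: L1_cont => x; exact: cst_continuous. Qed.

Lemma L1_sum (I : Type) (s : seq I) (F : I -> R -> R) :
  (forall i, L1 (F i)) -> L1 (fun x => \sum_(i <- s) F i x).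
Proof.
move=> LF; elim: s => [|i s IHs].
  by under eq_fun do rewrite big_nil; exact: L1_cst.
by under eq_fun do rewrite big_cons; exact: L1D.
Qed.

Lemma L1_measurable f : L1 f -> measurable_fun D f.
Proof. by move=> /measurable_int /measurable_EFinP. Qed.

Lemma cont_measurable f : {within D, continuous f} -> measurable_fun D f.
Proof. by move=> cf; exact: subspace_continuous_measurable_fun. Qed.

Lemma cont_bounded f : {within D, continuous f} ->
  exists2 M, 0 <= M & forall x, D x -> `|f x| <= M.
Proof.
move=> cf; have : compact (f @` D).
  by apply: continuous_compact => //; exact: segment_compact.
move=> /compact_bounded [M [Mr HM]].
exists (`|M| + 1); first by rewrite addr_ge0.
move=> x Dx; apply: (HM (`|M| + 1)).
  by rewrite ltr_pwDr// ler_norm.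
by exists x.
Qed.

Lemma L1_dominated f g : measurable_fun D f -> L1 g ->
  (forall x, D x -> `|f x| <= g x) -> L1 f.
Proof.
move=> mf Lg fg; apply: le_integrable Lg => //; first exact/measurable_EFinP.
move=> x Dx /=; rewrite lee_fin (le_trans (fg _ Dx))//.
by rewrite ler_norm.
Qed.

Lemma L1_contM f g : {within D, continuous f} -> L1 g -> L1 (fun x => f x * g x).
Proof.
move=> cf Lg; have [M M0 HM] := cont_bounded cf.
apply: (@L1_dominated _ (fun x => M * `|g x|)).
- by apply: measurable_funM; [exact: cont_measurable|exact: L1_measurable].
- exact/L1Z/L1_norm.
- by move=> x Dx; rewrite normrM ler_wpM2r// HM.
Qed.

Lemma primitive0 f : primitive f 0 = 0.
Proof. by rewrite /primitive set_itv1 Rintegral_set1. Qed.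

Lemma eq_primitive f g x : D x -> (forall y, D y -> f y = g y) ->
  primitive f x = primitive g x.
Proof.
move=> Dx fg; apply: eq_Rintegral => y /set_mem /(subset_I01 Dx) Dy.
exact: fg.
Qed.

Lemma primitiveD f g x : D x -> L1 f -> L1 g ->
  primitive (fun y => f y + g y) x = primitive f x + primitive g x.
Proof. by move=> Dx Lf Lg; rewrite /primitive RintegralD//; exact: L1_sub. Qed.

Lemma primitiveB f g x : D x -> L1 f -> L1 g ->
  primitive (fun y => f y - g y) x = primitive f x - primitive g x.
Proof. by move=> Dx Lf Lg; rewrite /primitive RintegralB//; exact: L1_sub. Qed.

Lemma primitiveZ r f x : D x -> L1 f ->
  primitive (fun y => r * f y) x = r * primitive f x.
Proof. by move=> Dx Lf; rewrite /primitive RintegralZl//; exact: L1_sub. Qed.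

Lemma primitive_sum n (c : nat -> R) (F : nat -> R -> R) x : D x ->
  (forall i, L1 (F i)) ->
  primitive (fun y => \sum_(i < n) c i * F i y) x =
  \sum_(i < n) c i * primitive (F i) x.
Proof.
move=> Dx LF; elim: n => [|n IHn].
  rewrite big_ord0 -[RHS](mul0r (primitive (F 0%N) x)) -primitiveZ//.
  by apply: eq_primitive => // y _; rewrite big_ord0 mul0r.
rewrite big_ord_recr /= -IHn -primitiveZ// -primitiveD//.
- by apply: eq_primitive => // y _; rewrite big_ord_recr.
- by apply: L1_sum => i; exact: L1Z.
- exact: L1Z.
Qed.

Lemma primitive_cst r x : D x -> primitive (fun=> r) x = r * x.
Proof.
move=> /I01P /andP[x0 _]; rewrite /primitive Rintegral_cst//.
rewrite /= lebesgue_measure_itv /= lte_fin oppr0 adde0.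
by rewrite lt_neqAle x0 andbT eq_sym; case: eqVneq => [->|//].
Qed.

Lemma le_primitive f g x : D x -> L1 f -> L1 g ->
  (forall y, 0 <= y <= x -> f y <= g y) -> primitive f x <= primitive g x.
Proof.
by move=> Dx Lf Lg fg; apply: le_Rintegral => //; exact: L1_sub.
Qed.

Lemma norm_primitive f x : D x -> L1 f ->
  `|primitive f x| <= primitive (fun y => `|f y|) x.
Proof. by move=> Dx Lf; apply: le_normr_Rintegral => //; exact: L1_sub. Qed.

Lemma primitive_cont f : L1 f -> {within D, continuous (primitive f)}.
Proof. by move=> Lf; exact: parameterized_integral_continuous. Qed.

Lemma primitive_itvB f x y : D x -> L1 f -> 0 <= y <= x ->
  primitive f x - primitive f y = \int[mu]_(s in `[y, x]) f s.
Proof.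
move=> Dx Lf /andP[y0 yx]; rewrite /primitive Rintegral_itvB ?bnd_simp//.
  rewrite Rintegral_itv_obnd_cbnd//.
  apply: integrableS (L1_sub Dx Lf) => // z /=.
  by rewrite !in_itv /= => /andP[yz ->]; rewrite (le_trans y0 (ltW yz)).
exact: L1_sub.
Qed.

Lemma primitive_ndecr f x y : D x -> L1 f -> 0 <= y <= x ->
  (forall s, D s -> 0 <= f s) -> primitive f y <= primitive f x.
Proof.
move=> Dx Lf yx f0; rewrite -subr_ge0 primitive_itvB//.
apply: Rintegral_ge0 => s /=; rewrite in_itv /= => /andP[ys sx].
apply: f0; apply: (subset_I01 Dx) => /=; rewrite in_itv /= sx andbT.
by case/andP: yx => /le_trans + _; apply.
Qed.

Lemma integrable_patch f (A : set (measurableTypeR R)) : measurable A ->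
  mu.-integrable A (EFin \o f) <-> mu.-integrable setT (EFin \o (f \_ A)).
Proof.
by move=> mA; rewrite -restrict_EFin; exact: (@integrable_mkcond _ _ _ mu A).
Qed.

(** Integration by parts when both factors are merely absolutely continuous:
    Fubini for f(s) g(y) on the triangle 0 <= y <= s <= x.  Everything below
    that differentiates a product reduces to this. *)
Lemma primitiveM f g x : D x -> L1 f -> L1 g ->
  primitive f x * primitive g x =
  primitive (fun s => f s * primitive g s + primitive f s * g s) x.
Proof.
move=> Dx Lf Lg.
have Lfx := L1_sub Dx Lf; have Lgx := L1_sub Dx Lg.
have LfG : L1 (fun s => f s * primitive g s).
  apply: eq_L1 (L1_contM (primitive_cont Lg) Lf) => s _; exact: mulrC.
have LFg : L1 (fun s => primitive f s * g s).
  exact: L1_contM (primitive_cont Lf) Lg.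
(* Exchange the order of integration for f(s) g(y) on y <= s <= x, extended by 0 to the plane. *)
rewrite primitiveD//; apply/eqP; rewrite -subr_eq; apply/eqP.
pose E : set R := `[0, x]%classic.
pose F := f \_ E; pose G := g \_ E.
have LF : mu.-integrable setT (EFin \o F).
  by apply: (integrable_patch _ (measurable_itv _)).1.
have LG : mu.-integrable setT (EFin \o G).
  by apply: (integrable_patch _ (measurable_itv _)).1.
have mF : measurable_fun setT F by move/measurable_int/measurable_EFinP : LF.
have mG : measurable_fun setT G by move/measurable_int/measurable_EFinP : LG.
pose T : set (R * R) := [set z | z.2 <= z.1].
pose H (z : R * R) : R := F z.1 * G z.2 * \1_T z.
have inT s y : ((s, y) \in T) = (y <= s) by apply/idP/idP; rewrite inE.
have inE' y : (y \in E) = (0 <= y <= x) by rewrite /E mem_setE in_itv.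
have mT : measurable T.
  rewrite (_ : T = setT `&` (fun z : R * R => z.2 <= z.1) @^-1` [set true]).
    by apply: measurable_fun_ler => //; exact: measurable_set1.
  by rewrite setTI; apply/seteqP; split => z /=.
have mH : measurable_fun setT (EFin \o H).
  apply/measurable_EFinP; apply: measurable_funM.
    by apply: measurable_funM; exact: measurableT_comp.
  exact: measurable_indic.
have iK : (mu \x mu)%E.-integrable setT (fun z => (F z.1 * G z.2)%:E).
  apply/integrable12ltyP.
    apply/measurable_EFinP.
    by apply: measurable_funM; exact: measurableT_comp.
  rewrite (eq_integral (fun s : measurableTypeR R =>
    (\int[mu]_y `|(G y)%:E|) * `|(F s)%:E|)%E); last first.
    move=> s _ /=; rewrite muleC -ge0_integralZl//=.
      by apply: eq_integral => y _; rewrite normrM EFinM.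
    by apply/measurable_EFinP; exact: measurableT_comp.
  have /integrableP[_ iF] := LF; have /integrableP[_ iG] := LG.
  rewrite ge0_integralZl//; last 2 first.
  - by apply/measurable_EFinP; exact: measurableT_comp.
  - exact: integral_ge0.
  by rewrite lte_mul_pinfty ?integral_ge0// ge0_fin_numE ?integral_ge0.
have iH : (mu \x mu)%E.-integrable setT (EFin \o H).
  apply: le_integrable iK => // z _; rewrite lee_fin /H.
  rewrite normrM; apply: ler_piMr => //.
  by rewrite /indic; case: (_ \in _) => /=; rewrite ?normr1 ?normr0.
have H1 s : (\int[mu]_y (EFin \o H) (s, y) = (F s * primitive g s)%:E)%E.
  rewrite /H /F /=; have [sE|sE] := boolP (s \in E); last first.
    rewrite patchE (negbTE sE) mul0r.
    by under eq_integral do rewrite mul0r mul0r; rewrite integral0.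
  have Es : 0 <= s <= x by move/set_mem : sE; rewrite /E /= in_itv.
  have Ds : D s by apply: (subset_I01 Dx); rewrite /= in_itv.
  have Lgs := L1_sub Ds Lg.
  rewrite patchE sE.
  rewrite (eq_integral (fun y : measurableTypeR R =>
    (f s)%:E * ((EFin \o g) \_ `[0%R, s]) y)%E); last first.
    move=> y _; rewrite restrict_EFin /= -EFinM -mulrA; congr (_ * _)%:E.
    rewrite /G indicE inT !patchE inE' mem_setE in_itv /=.
    case: (leP y s) => ys; last by rewrite mulr0 andbF.
    by rewrite mulr1 andbT (le_trans ys) ?andbT//; case/andP: Es.
  rewrite integralZl//; last by rewrite restrict_EFin; apply: (integrable_patch _ (measurable_itv _)).1.
  rewrite -integral_mkcond EFinM; congr (_ * _)%E.
  by rewrite /primitive /Rintegral fineK//; exact: integrable_fin_num.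
have H2 y : (\int[mu]_s (EFin \o H) (s, y) = (G y * (primitive f x - primitive f y))%:E)%E.
  rewrite /H /G /=; have [yE|yE] := boolP (y \in E); last first.
    rewrite patchE (negbTE yE) mul0r.
    by under eq_integral do rewrite mulr0 mul0r; rewrite integral0.
  have Ey : 0 <= y <= x by move/set_mem : yE; rewrite /E /= in_itv.
  have Lfy : mu.-integrable `[y, x] (EFin \o f).
    apply: integrableS Lfx => // z /=; rewrite !in_itv /= => /andP[yz ->].
    by rewrite andbT (le_trans _ yz)//; case/andP: Ey.
  rewrite patchE yE.
  rewrite (eq_integral (fun s : measurableTypeR R =>
    (g y)%:E * ((EFin \o f) \_ `[y, x]) s)%E); last first.
    move=> s _; rewrite restrict_EFin /= -EFinM; congr (_)%:E.
    rewrite mulrAC [RHS]mulrC; congr (_ * _).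
    rewrite /F indicE inT !patchE inE' mem_setE in_itv /=.
    case: (leP y s) => ys; last by rewrite mulr0.
    rewrite mulr1 (le_trans _ ys) //; by case/andP: Ey.
  rewrite integralZl//; last by rewrite restrict_EFin; apply: (integrable_patch _ (measurable_itv _)).1.
  rewrite -integral_mkcond EFinM; congr (_ * _)%E.
  rewrite primitive_itvB//.
  by rewrite /Rintegral fineK//; exact: integrable_fin_num.
have := Fubini iH.
under eq_integral do rewrite H1.
under [in X in _ = X -> _]eq_integral do rewrite H2.
move=> /(congr1 fine).
rewrite -/(Rintegral mu setT (fun s => F s * primitive g s)).
rewrite -/(Rintegral mu setT (fun s => G s * (primitive f x - primitive f s))).
have -> : (fun s => F s * primitive g s) = (fun s => f s * primitive g s) \_ E.
  by apply/funext => s; rewrite /F !patchE; case: ifP => //; rewrite mul0r.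
have -> : (fun s => G s * (primitive f x - primitive f s)) =
    (fun s => primitive f x * g s - primitive f s * g s) \_ E.
  apply/funext => s; rewrite /G !patchE; case: ifP; rewrite ?mul0r// => _.
  by ring.
rewrite -2!Rintegral_mkcond -/(primitive _ _) => ->.
rewrite -/(primitive (fun s => primitive f x * g s - primitive f s * g s) x).
by rewrite primitiveB//; [rewrite primitiveZ|exact: L1Z].
Qed.
End Integration.

#[local] Hint Resolve measurable_I01 I01_0 I01_1 : core.

(** * Absolutely continuous functions *)

Section WeakDerivative.
Context {R : realType}.
Local Notation D := (@I01 R).
Implicit Types f g F G : R -> R.

(** [F] is absolutely continuous on [0, 1] with almost everywhere derivative
    [f]. *)
Definition wderiv F f : Prop :=
  L1 f /\ forall x, D x -> F x = F 0 + primitive f x.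

Lemma wderivE F f x : wderiv F f -> D x -> primitive f x = F x - F 0.
Proof. by move=> [_ FE] Dx; rewrite (FE _ Dx); ring. Qed.

Lemma eq_wderiv F G f g : (forall x, D x -> F x = G x) ->
  (forall x, D x -> f x = g x) -> wderiv F f -> wderiv G g.
Proof.
move=> FG fg [Lf FE]; split; first exact: eq_L1 Lf.
by move=> x Dx; rewrite -!FG// FE// (eq_primitive Dx fg).
Qed.

Lemma wderiv_primitive f : L1 f -> wderiv (primitive f) f.
Proof. by move=> Lf; split => // x _; rewrite primitive0 add0r. Qed.

Lemma wderiv_cst r : wderiv (fun=> r) (fun=> 0).
Proof.
split; first exact: L1_cst.
by move=> x Dx; rewrite primitive_cst// mul0r addr0.
Qed.

Lemma wderiv_id : wderiv id (fun=> 1).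
Proof.
split; first exact: L1_cst.
by move=> x Dx; rewrite primitive_cst// mul1r add0r.
Qed.

Lemma wderivD F f G g : wderiv F f -> wderiv G g ->
  wderiv (fun x => F x + G x) (fun x => f x + g x).
Proof.
move=> [Lf FE] [Lg GE]; split; first exact: L1D.
by move=> x Dx; rewrite primitiveD// FE// GE//; ring.
Qed.

Lemma wderivZ r F f : wderiv F f -> wderiv (fun x => r * F x) (fun x => r * f x).
Proof.
move=> [Lf FE]; split; first exact: L1Z.
by move=> x Dx; rewrite primitiveZ// FE//; ring.
Qed.

Lemma wderivB F f G g : wderiv F f -> wderiv G g ->
  wderiv (fun x => F x - G x) (fun x => f x - g x).
Proof.
move=> Ff Gg; have := wderivD Ff (wderivZ (-1) Gg).
by apply: eq_wderiv => x Dx; ring.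
Qed.

Lemma wderiv_sum (I : Type) (s : seq I) (F f : I -> R -> R) :
  (forall i, wderiv (F i) (f i)) ->
  wderiv (fun x => \sum_(i <- s) F i x) (fun x => \sum_(i <- s) f i x).
Proof.
move=> Ff; elim: s => [|i s IHs].
  under eq_fun do rewrite big_nil; under [X in wderiv _ X]eq_fun do rewrite big_nil.
  exact: wderiv_cst.
under eq_fun do rewrite big_cons; under [X in wderiv _ X]eq_fun do rewrite big_cons.
exact: wderivD.
Qed.

Lemma wderiv_cont F f : wderiv F f -> {within D, continuous F}.
Proof.
move=> [Lf FE].
have : {within D, continuous (fun x => F 0 + primitive f x)}.
  by move=> x; apply: continuousD; [exact: cst_continuous|exact: primitive_cont].
move=> cP; apply: subspace_eq_continuous cP => x /set_mem Dx.
by rewrite /= [RHS]FE.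
Qed.

Lemma wderiv_L1 F f : wderiv F f -> L1 F.
Proof. by move=> /wderiv_cont; exact: L1_cont. Qed.

Lemma wderivM F f G g : wderiv F f -> wderiv G g ->
  wderiv (fun x => F x * G x) (fun x => f x * G x + F x * g x).
Proof.
move=> Ff Gg; have [Lf FE] := Ff; have [Lg GE] := Gg.
have H : wderiv (fun x => primitive f x * primitive g x)
    (fun x => f x * primitive g x + primitive f x * g x).
  split; last by move=> x Dx; rewrite primitive0 mul0r add0r primitiveM.
  apply: L1D; last exact/L1_contM/Lg/primitive_cont.
  have := L1_contM (primitive_cont Lg) Lf; apply: eq_L1 => x _; exact: mulrC.
have := wderivD (wderiv_cst (F 0 * G 0))
  (wderivD (wderivD (wderivZ (F 0) (wderiv_primitive Lg))
                    (wderivZ (G 0) (wderiv_primitive Lf))) H).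
by apply: eq_wderiv => x Dx; rewrite ?(FE _ Dx) ?(GE _ Dx); ring.
Qed.

End WeakDerivative.

Section SquareIntegrable.
Context {R : realType}.
Local Notation mu := (@lebesgue_measure R).
Local Notation D := (@I01 R).
Implicit Types f g F G : R -> R.

(** Square integrability by a measurability and an integrability condition,
    which are easier to combine than the finiteness of a norm. *)
Lemma L2P f : L2 f <-> measurable_fun D f /\ L1 (fun x => f x ^+ 2).
Proof.
split.
  move=> L2f; split.
    move: L2f; rewrite /L2 inE => /andP[+ _]; rewrite inE /= => mf.
    by apply/(measurable_restrictT _ measurable_I01).
  have := Lfun2_integrable_sqr L2f.
  rewrite /L1 => H; apply/integrable_patch => //.
  apply: eq_integrable H => // x _ /=; congr EFin.
  by rewrite !patchE; case: ifP => //; rewrite expr0n.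
move=> [mf Lf]; rewrite /L2 inE; apply/andP; split.
  by rewrite inE /=; apply/(measurable_restrictT _ measurable_I01).
rewrite inE /= /finite_norm unlock; apply: poweR_lty.
have := (integrable_patch _ measurable_I01).1 Lf.
move/integrableP => [_]; apply: le_lt_trans; rewrite le_eqVlt; apply/orP; left.
apply/eqP/eq_integral => x _ /=.
congr EFin.
rewrite (powR_mulrn 2)// !patchE; case: ifP => _; last by rewrite normr0 expr0n.
by rewrite real_normK ?num_real// ger0_norm ?sqr_ge0.
Qed.

Lemma l2norm_ge0 f : 0 <= l2norm f.
Proof. by rewrite fine_ge0// Lnorm_ge0. Qed.

Lemma l2norm_sqr f : L2 f -> l2norm f ^+ 2 = ip f f.
Proof.
move=> L2f; have : (finite_norm mu 2%:E (f \_ D))%E.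
  by move: L2f; rewrite /L2 inE => /andP[_]; rewrite inE.
rewrite /finite_norm /l2norm; set N := ('N[mu]_2%:E[_])%E => Noo.
have N0 : (0 <= N)%E := Lnorm_ge0 _ _ _.
have /fineK NE : N \is a fin_num by rewrite ge0_fin_numE.
have := @poweR_Lnorm _ _ _ mu (EFin \o (f \_ D)) 2.
rewrite -/N -NE => /(_ (negbT (@pnatr_eq0 R 2))).
rewrite poweR_EFin (powR_mulrn 2) ?fine_ge0// => /(congr1 fine) /= ->.
rewrite /ip Rintegral_mkcond; congr fine; apply: eq_integral => x _ /=.
congr EFin.
rewrite (powR_mulrn 2)// !patchE; case: ifP => _; last by rewrite normr0 expr0n.
by rewrite real_normK ?num_real// expr2.
Qed.

End SquareIntegrable.

(** * The space L2(0,1) *)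

Section Hilbert.
Context {R : realType}.
Local Notation mu := (@lebesgue_measure R).
Local Notation D := (@I01 R).
Implicit Types f g h : R -> R.

Lemma eq_L2 f g : (forall x, D x -> f x = g x) -> L2 f -> L2 g.
Proof.
move=> fg /L2P[mf Lf]; apply/L2P; split.
  by apply: eq_measurable_fun mf => x /set_mem; exact: fg.
by apply: eq_L1 Lf => x Dx; rewrite fg.
Qed.

Lemma L2_cont f : {within D, continuous f} -> L2 f.
Proof.
move=> cf; apply/L2P; split; first exact: cont_measurable.
by apply: eq_L1 (L1_contM cf (L1_cont cf)) => x _; rewrite expr2.
Qed.

Lemma L2_cst r : L2 (fun=> r : R).
Proof. by apply: L2_cont => x; exact: cst_continuous. Qed.

Lemma L2Z r f : L2 f -> L2 (fun x => r * f x).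
Proof.
move=> /L2P[mf Lf]; apply/L2P; split; first exact: measurable_funM.
by apply: eq_L1 (L1Z (r ^+ 2) Lf) => x _; rewrite exprMn.
Qed.

Lemma L2_norm f : L2 f -> L2 (fun x => `|f x|).
Proof.
move=> /L2P[mf Lf]; apply/L2P; split; first exact: measurableT_comp.
by apply: eq_L1 Lf => x _; rewrite real_normK ?num_real.
Qed.

Lemma L2D f g : L2 f -> L2 g -> L2 (fun x => f x + g x).
Proof.
move=> /L2P[mf Lf] /L2P[mg Lg]; apply/L2P; split; first exact: measurable_funD.
apply: L1_dominated (L1Z 2 (L1D Lf Lg)) _.
  by apply: measurable_funX; exact: measurable_funD.
by move=> x _; rewrite ger0_norm ?sqr_ge0//; have := sqr_ge0 (f x - g x); nra.
Qed.

Lemma L2B f g : L2 f -> L2 g -> L2 (fun x => f x - g x).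
Proof.
move=> Lf Lg; apply: eq_L2 (L2D Lf (L2Z (-1) Lg)) => x _; ring.
Qed.

Lemma L2_sum (I : Type) (s : seq I) (F : I -> R -> R) :
  (forall i, L2 (F i)) -> L2 (fun x => \sum_(i <- s) F i x).
Proof.
move=> LF; elim: s => [|i s IHs].
  by under eq_fun do rewrite big_nil; exact: L2_cst.
by under eq_fun do rewrite big_cons; exact: L2D.
Qed.

Lemma L2M f g : L2 f -> L2 g -> L1 (fun x => f x * g x).
Proof.
move=> /L2P[mf Lf] /L2P[mg Lg]; apply: L1_dominated (L1D Lf Lg) _.
  exact: measurable_funM.
move=> x _; rewrite normrM -(real_normK (num_real (f x))).
rewrite -(real_normK (num_real (g x))).
by have := sqr_ge0 (`|f x| - `|g x|); have := sqr_ge0 (`|f x| + `|g x|); nra.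
Qed.

Lemma L2_L1 f : L2 f -> L1 f.
Proof. by move=> Lf; apply: eq_L1 (L2M Lf (L2_cst 1)) => x _; rewrite mulr1. Qed.

Lemma L2_wderiv F f : wderiv F f -> L2 F.
Proof. by move=> /wderiv_cont; exact: L2_cont. Qed.

Lemma eq_ip f f' g g' : (forall x, D x -> f x = f' x) ->
  (forall x, D x -> g x = g' x) -> ip f g = ip f' g'.
Proof.
by move=> ff gg; apply: eq_Rintegral => x /set_mem Dx; rewrite ff// gg.
Qed.

Lemma ipC f g : ip f g = ip g f.
Proof. by apply: eq_Rintegral => x _; rewrite mulrC. Qed.

Lemma ipDr f g h : L2 f -> L2 g -> L2 h ->
  ip f (fun x => g x + h x) = ip f g + ip f h.
Proof.
move=> Lf Lg Lh; rewrite -RintegralD//; try exact: L2M.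
by apply: eq_Rintegral => x _; rewrite mulrDr.
Qed.

Lemma ipZr f r g : L2 f -> L2 g -> ip f (fun x => r * g x) = r * ip f g.
Proof.
move=> Lf Lg; rewrite -RintegralZl//; last exact: L2M.
by apply: eq_Rintegral => x _; rewrite mulrCA.
Qed.

Lemma ipBr f g h : L2 f -> L2 g -> L2 h ->
  ip f (fun x => g x - h x) = ip f g - ip f h.
Proof.
move=> Lf Lg Lh; rewrite -RintegralB//; try exact: L2M.
by apply: eq_Rintegral => x _; rewrite mulrBr.
Qed.

Lemma ipDl f g h : L2 f -> L2 g -> L2 h ->
  ip (fun x => g x + h x) f = ip g f + ip h f.
Proof. by move=> *; rewrite ipC ipDr// ipC [ip f h]ipC. Qed.

Lemma ipBl f g h : L2 f -> L2 g -> L2 h ->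
  ip (fun x => g x - h x) f = ip g f - ip h f.
Proof. by move=> *; rewrite ipC ipBr// ipC [ip f h]ipC. Qed.

Lemma ipZl f r g : L2 f -> L2 g -> ip (fun x => r * g x) f = r * ip g f.
Proof. by move=> *; rewrite ipC ipZr// ipC. Qed.

Lemma ip_ge0 f : 0 <= ip f f.
Proof. by apply: Rintegral_ge0 => x _; rewrite -expr2 sqr_ge0. Qed.

(** The case c = 0 has to be included because the second function in the
    Cauchy-Schwarz inequality may vanish almost everywhere. *)
Lemma discriminant_le0 (a b c : R) : 0 <= c ->
  (forall r, 0 <= a - 2 * r * b + r ^+ 2 * c) -> b ^+ 2 <= a * c.
Proof.
move=> c_ge0 H; have [c0|c0] := eqVneq c 0.
  rewrite c0 mulr0; suff -> : b = 0 by rewrite expr0n.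
  apply: contrapT => /eqP b0; have := H ((a + 1) / (2 * b)).
  rewrite c0 mulr0 addr0 (_ : 2 * _ * b = a + 1); last by field.
  lra.
have c1 : 0 < c by rewrite lt_neqAle eq_sym c0.
have := H (b / c); rewrite (_ : _ + _ = (a * c - b ^+ 2) / c); last by field.
by rewrite pmulr_lge0 ?invr_gt0// subr_ge0.
Qed.

Lemma cauchy_schwarz f g : L2 f -> L2 g -> `|ip f g| <= l2norm f * l2norm g.
Proof.
move=> Lf Lg; rewrite -ler_sqr ?nnegrE ?mulr_ge0 ?l2norm_ge0//.
rewrite exprMn !l2norm_sqr// real_normK ?num_real//.
apply: discriminant_le0; [exact: ip_ge0|move=> r].
have := ip_ge0 (fun x => f x - r * g x).
have Lrg := L2Z r Lg; have Lfr := L2B Lf Lrg.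
rewrite ipBl// !ipBr// !ipZl// !ipZr// [ip g f]ipC.
by move=> H; apply: (le_trans H); rewrite le_eqVlt; apply/orP; left; apply/eqP; ring.
Qed.

Lemma l2norm_le f c : L2 f -> 0 <= c -> ip f f <= c ^+ 2 -> l2norm f <= c.
Proof. by move=> Lf c0; rewrite -l2norm_sqr// ler_sqr ?nnegrE ?l2norm_ge0. Qed.

Lemma l2norm_triangle f g : L2 f -> L2 g ->
  l2norm (fun x => f x + g x) <= l2norm f + l2norm g.
Proof.
move=> Lf Lg; apply: l2norm_le; [exact: L2D|by rewrite addr_ge0 ?l2norm_ge0|].
have Lfg := L2D Lf Lg; rewrite ipDl// !ipDr// [ip g f]ipC -!l2norm_sqr//.
have := le_trans (ler_norm _) (cauchy_schwarz Lf Lg).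
by move=> H; nra.
Qed.

Lemma eq_l2norm f g : (forall x, D x -> f x = g x) -> l2norm f = l2norm g.
Proof.
move=> fg; rewrite /l2norm; congr fine; apply: eq_Lnorm => x /=; congr EFin.
by rewrite !patchE; case: ifPn => // /set_mem/fg.
Qed.

Lemma l2normZ r f : L2 f -> l2norm (fun x => r * f x) = `|r| * l2norm f.
Proof.
move=> Lf; apply/eqP; rewrite -(@eqrXn2 _ 2) ?l2norm_ge0//; last first.
  by rewrite mulr_ge0 ?l2norm_ge0.
have LZ := L2Z r Lf.
rewrite exprMn !l2norm_sqr// ipZl// ipZr// real_normK ?num_real//.
by apply/eqP; ring.
Qed.

Lemma l2norm_distrC f g : L2 f -> L2 g ->
  l2norm (fun x => f x - g x) = l2norm (fun x => g x - f x).
Proof.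
move=> Lf Lg; rewrite -[RHS]mul1r -[in RHS](normr1 R) -(normrN 1) -l2normZ//.
  by apply: eq_l2norm => x _; ring.
exact: L2B.
Qed.

Lemma l2norm_cst r : l2norm (fun=> r : R) = `|r|.
Proof.
apply/eqP; rewrite -(@eqrXn2 _ 2) ?l2norm_ge0// l2norm_sqr; last exact: L2_cst.
by rewrite /ip -/(primitive (fun=> r * r) 1) primitive_cst// mulr1 real_normK ?num_real// expr2.
Qed.

Lemma l2norm_sum (I : Type) (s : seq I) (F : I -> R -> R) :
  (forall i, L2 (F i)) ->
  l2norm (fun x => \sum_(i <- s) F i x) <= \sum_(i <- s) l2norm (F i).
Proof.
move=> LF; elim: s => [|i s IHs].
  under eq_fun do rewrite big_nil; rewrite big_nil.
  by rewrite l2norm_cst normr0.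
under eq_fun do rewrite big_cons; rewrite big_cons.
apply: le_trans (l2norm_triangle _ _) _ => //; first exact: L2_sum.
by rewrite lerD2l.
Qed.

Lemma le_ip f g h k : L2 f -> L2 g -> L2 h -> L2 k ->
  (forall x, D x -> f x * g x <= h x * k x) -> ip f g <= ip h k.
Proof. by move=> Lf Lg Lh Lk H; apply: le_Rintegral => //; exact: L2M. Qed.

Lemma le_l2norm f g : L2 f -> L2 g ->
  (forall x, D x -> `|f x| <= g x) -> l2norm f <= l2norm g.
Proof.
move=> Lf Lg fg; apply: l2norm_le; rewrite ?l2norm_ge0// l2norm_sqr//.
apply: le_ip => // x Dx; rewrite -!expr2 -[f x ^+ 2]real_normK ?num_real//.
by rewrite lerXn2r ?nnegrE ?fg// (le_trans _ (fg _ Dx)).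
Qed.

Lemma l2norm_norm f : L2 f -> l2norm (fun x => `|f x|) = l2norm f.
Proof.
move=> Lf; have Lnf := L2_norm Lf.
apply/eqP; rewrite -(@eqrXn2 _ 2) ?l2norm_ge0// !l2norm_sqr//.
by apply/eqP/eq_Rintegral => y _; rewrite -!expr2 real_normK ?num_real.
Qed.

Lemma primitive_le_l2norm f x : L2 f -> D x ->
  primitive (fun y => `|f y|) x <= l2norm f.
Proof.
move=> Lf Dx; have LL := L1_norm (L2_L1 Lf).
have Lnf := L2_norm Lf.
apply: (@le_trans _ _ (primitive (fun y => `|f y|) 1)).
  by apply: primitive_ndecr => //; exact/I01P.
apply: (@le_trans _ _ (ip (fun y => `|f y|) (fun=> 1))).
  by rewrite /ip; under eq_Rintegral do rewrite mulr1.
apply: le_trans (ler_norm _) _; apply: le_trans (cauchy_schwarz _ _) _ => //.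
  exact: L2_cst.
by rewrite l2norm_cst normr1 mulr1 l2norm_norm.
Qed.

End Hilbert.

(** * The operator x int_0^x and its truncated exponentials *)

Section Generator.
Context {R : realType}.
Local Notation D := (@I01 R).
Implicit Types f g h w : R -> R.

(** The operator S above, generator of the backstepping transformation. *)
Definition gen f (x : R) : R := x * primitive f x.

Definition expgen N (s : R) f (x : R) : R :=
  \sum_(n < N) s ^+ n / n`!%:R * iter n gen f x.

Lemma gen_wderiv f : L1 f -> wderiv (gen f) (fun x => primitive f x + x * f x).
Proof.
move=> Lf; apply: eq_wderiv (wderivM wderiv_id (wderiv_primitive Lf)) => // x _.
by rewrite mul1r.
Qed.

Lemma gen_cont f : L1 f -> {within D, continuous (gen f)}.
Proof. by move=> /gen_wderiv /wderiv_cont. Qed.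

Lemma L1_gen f : L1 f -> L1 (gen f).
Proof. by move=> /gen_cont /L1_cont. Qed.

Lemma L1_iter_gen n f : L1 f -> L1 (iter n gen f).
Proof. by move=> Lf; elim: n => //= n; exact: L1_gen. Qed.

Lemma L2_iter_gen n f : L2 f -> L2 (iter n gen f).
Proof.
move=> Lf; case: n => //= n.
by apply/L2_cont/gen_cont/L1_iter_gen/L2_L1.
Qed.

Lemma eq_gen f g : (forall x, D x -> f x = g x) ->
  forall x, D x -> gen f x = gen g x.
Proof. by move=> fg x Dx; rewrite /gen (eq_primitive Dx fg). Qed.

Lemma eq_iter_gen n f g : (forall x, D x -> f x = g x) ->
  forall x, D x -> iter n gen f x = iter n gen g x.
Proof. by move=> fg; elim: n => //= n IHn; exact: eq_gen. Qed.

Lemma genD f g x : D x -> L1 f -> L1 g ->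
  gen (fun y => f y + g y) x = gen f x + gen g x.
Proof. by move=> Dx Lf Lg; rewrite /gen primitiveD// mulrDr. Qed.

Lemma genZ r f x : D x -> L1 f -> gen (fun y => r * f y) x = r * gen f x.
Proof. by move=> Dx Lf; rewrite /gen primitiveZ// mulrCA. Qed.

Lemma iter_genD n f g x : D x -> L1 f -> L1 g ->
  iter n gen (fun y => f y + g y) x = iter n gen f x + iter n gen g x.
Proof.
move=> Dx Lf Lg; elim: n x Dx => //= n IHn x Dx.
by rewrite (eq_gen IHn Dx) genD//; exact: L1_iter_gen.
Qed.

Lemma iter_genZ n r f x : D x -> L1 f ->
  iter n gen (fun y => r * f y) x = r * iter n gen f x.
Proof.
move=> Dx Lf; elim: n x Dx => //= n IHn x Dx.
by rewrite (eq_gen IHn Dx) genZ//; exact: L1_iter_gen.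
Qed.

Lemma iter_gen0 n x : D x -> iter n gen (fun=> 0 : R) x = 0.
Proof.
elim: n x => //= n IHn x Dx.
by rewrite (eq_gen IHn Dx) /gen primitive_cst// mul0r mulr0.
Qed.

Lemma iter_gen_sum n (I : Type) (s : seq I) (F : I -> R -> R) x : D x ->
  (forall i, L1 (F i)) ->
  iter n gen (fun y => \sum_(i <- s) F i y) x = \sum_(i <- s) iter n gen (F i) x.
Proof.
move=> Dx LF; elim: s => [|i s IHs].
  rewrite big_nil -[RHS](iter_gen0 n Dx); apply: eq_iter_gen => // y _.
  by rewrite big_nil.
rewrite big_cons -IHs -iter_genD//; last exact: L1_sum.
by apply: eq_iter_gen => // y _; rewrite big_cons.
Qed.

Lemma L2_expgen N s f : L2 f -> L2 (expgen N s f).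
Proof. by move=> Lf; apply: L2_sum => n; exact/L2Z/L2_iter_gen. Qed.

Lemma eq_expgen N s f g : (forall x, D x -> f x = g x) ->
  forall x, D x -> expgen N s f x = expgen N s g x.
Proof.
by move=> fg x Dx; apply: eq_bigr => n _; rewrite (eq_iter_gen n fg).
Qed.

Lemma expgenD N s f g x : D x -> L1 f -> L1 g ->
  expgen N s (fun y => f y + g y) x = expgen N s f x + expgen N s g x.
Proof.
move=> Dx Lf Lg; rewrite /expgen -big_split; apply: eq_bigr => n _ /=.
by rewrite iter_genD// mulrDr.
Qed.

Lemma expgenZ N s r f x : D x -> L1 f ->
  expgen N s (fun y => r * f y) x = r * expgen N s f x.
Proof.
move=> Dx Lf; rewrite /expgen big_distrr; apply: eq_bigr => n _ /=.
by rewrite iter_genZ// mulrCA.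
Qed.

(** The derivative of [iter n gen w], in a form in which its value at x = 1 can
    be read off. *)
Definition diter_gen n w wx (x : R) : R :=
  if n is m.+1 then primitive (iter m gen w) x + x * iter m gen w x else wx x.

(** The commutator relation D^2 S = S D^2 + 2, iterated: since w'(0) = 0, one
    has (S g)'' = 2 g + x g' = 2 g + S g''.  The vanishing of the derivative at
    0 is preserved, which lets the induction go through. *)
Lemma iter_gen_wderiv2 n w wx wxx : wderiv w wx -> wderiv wx wxx -> wx 0 = 0 ->
  [/\ wderiv (iter n gen w) (diter_gen n w wx),
      wderiv (diter_gen n w wx)
        (fun x => iter n gen wxx x + 2 * n%:R * iter n.-1 gen w x) &
      diter_gen n w wx 0 = 0].
Proof.
move=> Hw Hwx wx0; elim: n => [|n [IH1 IH2 IH3]] /=.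
  by split => //; apply: eq_wderiv Hwx => // x _; rewrite mulr0 mul0r addr0.
(* (S g)'' = 2 g + x g' with g = S^n w, and g'(0) = 0 makes g' a primitive of g''. *)
have Lw := L1_iter_gen n (wderiv_L1 Hw); split.
- exact: gen_wderiv.
- have := wderivD (wderiv_primitive Lw) (wderivM wderiv_id IH1).
  apply: eq_wderiv => x Dx //=.
  have -> : x * diter_gen n w wx x =
      gen (iter n gen wxx) x + 2 * n%:R * iter n gen w x.
    rewrite -[diter_gen _ _ _ _]subr0 -{1}IH3 -(wderivE IH2 Dx).
    have Lxx := L1_iter_gen n Hwx.1; have Lw1 := L1_iter_gen n.-1 (wderiv_L1 Hw).
    rewrite primitiveD// ?primitiveZ//; last exact: L1Z.
    rewrite mulrDr -/(gen _ _) mulrCA -/(gen _ _).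
    by case: (n) => [|m]//=; rewrite mulr0 !mul0r.
  by rewrite -natr1; ring.
- by rewrite primitive0 mul0r addr0.
Qed.

Definition dexpgen N s w wx (x : R) : R :=
  \sum_(n < N) s ^+ n / n`!%:R * diter_gen n w wx x.

(** Summing the commutator relations gives D^2 exp (s S) = exp (s S) (D^2 + 2 s);
    truncation shifts the order of the last term by one. *)
Lemma expgen_wderiv2 N s w wx wxx : wderiv w wx -> wderiv wx wxx -> wx 0 = 0 ->
  [/\ wderiv (expgen N.+1 s w) (dexpgen N.+1 s w wx),
      wderiv (dexpgen N.+1 s w wx)
        (fun x => expgen N.+1 s wxx x + 2 * s * expgen N s w x) &
      dexpgen N.+1 s w wx 0 = 0].
Proof.
move=> Hw Hwx wx0; have H n := iter_gen_wderiv2 n Hw Hwx wx0; split.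
- by apply: wderiv_sum => n; apply: wderivZ; case: (H n).
- have := @wderiv_sum R _ (index_enum 'I_N.+1)
    (fun n x => s ^+ n / n`!%:R * diter_gen n w wx x)
    (fun n x => s ^+ n / n`!%:R *
      (iter n gen wxx x + 2 * n%:R * iter n.-1 gen w x)).
  move=> /(_ (fun n => wderivZ _ (let: And3 _ h _ := H n in h))).
  apply: eq_wderiv => x Dx //.
  under eq_bigr do rewrite mulrDr; rewrite big_split /=; congr (_ + _).
  rewrite big_ord_recl /= mulr0 mul0r mulr0 add0r.
  rewrite /expgen big_distrr; apply: eq_bigr => n _ /=.
  rewrite factS natrM exprS /bump /= add1n.
  field.
  by rewrite nat1r !pnatr_eq0 -!lt0n fact_gt0.
- by apply: big1 => n _; case: (H n) => _ _ ->; rewrite mulr0.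
Qed.

Definition moment m f (x : R) : R := primitive (fun y => (x ^+ 2 - y ^+ 2) ^+ m * f y) x.

Lemma sqr_cont : continuous (fun y : R => y ^+ 2).
Proof. exact: exprn_continuous. Qed.

Lemma within_cont f : continuous f -> {within D, continuous f}.
Proof. by move=> cf; exact: continuous_subspaceT. Qed.

Lemma L1_moment_integrand m x f : L1 f -> L1 (fun y => (x ^+ 2 - y ^+ 2) ^+ m * f y).
Proof.
move=> Lf; apply: L1_contM => //; apply: within_cont.
elim: m => [|m IHm] y; first exact: cst_continuous.
under [X in continuous_at _ X]eq_fun do rewrite exprS.
apply: continuousM (IHm y).
by apply: continuousB; [exact: cst_continuous|exact: sqr_cont].
Qed.

Lemma L1_sqrM f : L1 f -> L1 (fun y => y ^+ 2 * f y).
Proof. by move=> Lf; apply: L1_contM => //; exact/within_cont/sqr_cont. Qed.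

Lemma momentS m f x : D x -> L1 f ->
  moment m.+1 f x = x ^+ 2 * moment m f x - moment m (fun y => y ^+ 2 * f y) x.
Proof.
move=> Dx Lf; have L1m := L1_moment_integrand m x Lf.
have L2m := L1_moment_integrand m x (L1_sqrM Lf).
rewrite /moment -primitiveZ// -primitiveB//; last exact: L1Z.
by apply: eq_primitive => // y _; rewrite exprS; ring.
Qed.

Lemma wderiv_sqr : wderiv (fun x : R => x ^+ 2) (fun x => 2 * x).
Proof.
have := wderivM (@wderiv_id R) (@wderiv_id R).
by apply: eq_wderiv => x _; rewrite ?expr2//=; ring.
Qed.

(** (x^2 - y^2)^(m+1) = x^2 (x^2 - y^2)^m - (x^2 - y^2)^m y^2 reduces the case
    m + 1 for f to the case m for f and y^2 f; the product rule for x^2 is then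
    the only differentiation, so no derivative is taken under the integral. *)
Lemma moment_wderiv m f : L1 f ->
  wderiv (moment m.+1 f) (fun s => 2 * m.+1%:R * s * moment m f s).
Proof.
elim: m f => [|m IHm] f Lf.
  have M0 g x : D x -> moment 0 g x = primitive g x.
    by move=> Dx; apply: eq_primitive => // y _; rewrite expr0 mul1r.
  have := wderivB (wderivM wderiv_sqr (wderiv_primitive Lf))
    (wderiv_primitive (L1_sqrM Lf)).
  apply: eq_wderiv => x Dx; rewrite ?momentS// !M0//; ring.
have := wderivB (wderivM wderiv_sqr (IHm f Lf)) (IHm _ (L1_sqrM Lf)).
apply: eq_wderiv => x Dx; first by rewrite [RHS]momentS.
by rewrite momentS// -[in RHS]natr1; ring.
Qed.

(** The kernel of S^(m+1), whose exponential sum is the Bessel kernel. *)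
Lemma iter_gen_moment m f x : D x -> L1 f ->
  iter m.+1 gen f x = x / (2 ^+ m * m`!%:R) * moment m f x.
Proof.
move=> Dx Lf; elim: m x Dx => [|m IHm] x Dx.
  rewrite /= /gen expr0 mul1r divr1; congr (_ * _).
  by apply: eq_primitive => // y _; rewrite expr0 mul1r.
rewrite iterS (eq_gen IHm Dx) /gen.
have := wderivE (moment_wderiv m Lf) Dx.
rewrite {3}/moment primitive0 subr0 => <-.
rewrite factS natrM exprS -mulrA; congr (_ * _).
rewrite -primitiveZ//; last exact: (moment_wderiv m Lf).1.
apply: eq_primitive => // y _; field.
by rewrite expf_neq0// nat1r !pnatr_eq0 -!lt0n fact_gt0.
Qed.

End Generator.

(** * Norms of the truncated exponentials *)

Section ExpSum.
Context {R : realType}.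
Implicit Types (x y : R) (a : nat -> R).

Definition expsum N x : R := \sum_(n < N) x ^+ n / n`!%:R.

Lemma expsumE x : expsum ^~ x = series (exp_coeff x).
Proof.
by apply/funext => N; rewrite /series /= /expsum big_mkord.
Qed.

Lemma expsum_cvg x : expsum ^~ x @ \oo --> expR x.
Proof. by rewrite expsumE; exact: is_cvg_series_exp_coeff. Qed.

Lemma expsum_le x N : 0 <= x -> expsum N x <= expR x.
Proof.
move=> x0; rewrite -[expsum N x]/((expsum ^~ x) N) expsumE.
apply: nondecreasing_cvgn_le; last exact: is_cvg_series_exp_coeff.
apply/nondecreasing_seqP => n; rewrite /series /= big_nat_recr//= lerDl.
by rewrite divr_ge0 ?exprn_ge0.
Qed.

Lemma sum_triangle (G : nat -> nat -> R) N :
  \sum_(j < N) \sum_(0 <= i < N - j) G i j = \sum_(k < N) \sum_(j < k.+1) G (k - j)%N j.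
Proof.
elim: N => [|N IHN]; first by rewrite !big_ord0.
rewrite big_ord_recr /= [RHS]big_ord_recr /= -IHN subSnn big_nat1.
rewrite [X in _ = _ + X]big_ord_recr /= subnn addrA; congr (_ + _).
rewrite -big_split; apply: eq_bigr => j _ /=.
by rewrite subSn 1?ltnW// big_nat_recr.
Qed.

(** The binomial theorem in the form exp (x + y) = exp x exp y, restricted to
    the terms of total degree less than [N]; the sequence [a] stands for the
    orbit of a function under S. *)
Lemma exp_triangle x y a N :
  \sum_(j < N) \sum_(0 <= i < N - j) x ^+ i / i`!%:R * (y ^+ j / j`!%:R * a (i + j)%N)
  = \sum_(k < N) (x + y) ^+ k / k`!%:R * a k.
Proof.
rewrite (sum_triangle (fun i j => x ^+ i / i`!%:R * (y ^+ j / j`!%:R * a (i + j)%N))).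
apply: eq_bigr => k _; rewrite exprDn !big_distrl /=.
apply: eq_bigr => j _; rewrite subnK; last by rewrite -ltnS.
have jk : (j <= k)%N by rewrite -ltnS.
rewrite -(bin_fact jk) !natrM -[in RHS]mulr_natr.
have h n : (n`!%:R != 0 :> R) by rewrite pnatr_eq0 -lt0n fact_gt0.
have hb : ('C(k, j)%:R != 0 :> R) by rewrite pnatr_eq0 -lt0n bin_gt0.
by field; rewrite !h hb.
Qed.

End ExpSum.

Section Bounds.
Context {R : realType}.
Local Notation D := (@I01 R).
Implicit Types f g h w : R -> R.

Lemma l2norm_gen f : L2 f -> l2norm (gen f) <= l2norm f.
Proof.
move=> Lf; rewrite -[leRHS](ger0_norm (l2norm_ge0 f)) -l2norm_cst.
apply: le_l2norm; [exact: (L2_iter_gen 1)|exact: L2_cst|].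
move=> x Dx; have /I01P /andP[x0 x1] := Dx.
rewrite /gen normrM ger0_norm// (le_trans (ler_wpM2r _ x1))//.
rewrite mul1r (le_trans (norm_primitive Dx (L2_L1 Lf)))//.
exact: primitive_le_l2norm.
Qed.

Lemma l2norm_iter_gen n f : L2 f -> l2norm (iter n gen f) <= l2norm f.
Proof.
move=> Lf; elim: n => //= n; apply: le_trans.
by apply: l2norm_gen; exact: L2_iter_gen.
Qed.

Lemma gauss_cont (r : R) : {within D, continuous (fun x => expR (r * x ^+ 2))}.
Proof.
apply: within_cont => x; apply: continuous_comp; last exact: continuous_expR.
by apply: continuousM; [exact: cst_continuous|exact: sqr_cont].
Qed.

Definition gaussnorm (r : R) : R := l2norm (fun x => expR (r * x ^+ 2)).

(** The L2 norm over the unit square of t exp (t (x^2 - y^2) / 2), which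
    dominates the kernels of exp (t S) - 1 and exp (- t S) - 1. *)
Definition hsbound (t : R) : R := t * (gaussnorm (t / 2) * gaussnorm (- (t / 2))).

(** The kernel of exp (s S) - 1 is at most
    |s| exp (|s| (x^2 - y^2) / 2) in absolute value because x <= 1 and
    1 <= (m+1)!; this majorant is a product of a function of x and a function
    of y, so that Cauchy-Schwarz in y alone is enough. *)
Lemma expgen_sub_le N s f x : D x -> L2 f ->
  `|expgen N.+1 s f x - f x| <=
  `|s| * gaussnorm (- (`|s| / 2)) * l2norm f * expR (`|s| / 2 * x ^+ 2).
Proof.
move=> Dx L2f; have Lf := L2_L1 L2f; set t := `|s|.
have t0 : 0 <= t by exact: normr_ge0.
have /I01P /andP[x0 x1] := Dx.
have xy0 y : 0 <= y <= x -> 0 <= x ^+ 2 - y ^+ 2.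
  by move=> /andP[y0 yx]; rewrite subr_ge0 lerXn2r// nnegrE.
have Lnf := L1_norm Lf.
pose c m : R := t ^+ m.+1 / m.+1`!%:R / (2 ^+ m * m`!%:R).
have c0 m : 0 <= c m by rewrite /c !divr_ge0 ?mulr_ge0 ?exprn_ge0.
have fact_neq0 n : (n`!%:R != 0 :> R) by rewrite pnatr_eq0 -lt0n fact_gt0.
apply: (@le_trans _ _ (\sum_(m < N) c m * moment m (fun y => `|f y|) x)).
  rewrite /expgen big_ord_recl /= expr0 fact0 divr1 mul1r addrC addKr.
  apply: le_trans (ler_norm_sum _ _ _) _; apply: ler_sum => m _.
  rewrite /bump add1n -/(iter m.+1 gen f) iter_gen_moment//.
  have -> : `|s ^+ m.+1 / m.+1`!%:R * (x / (2 ^+ m * m`!%:R) * moment m f x)| =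
      c m * (x * `|moment m f x|).
    rewrite !normrM !normfV !normrM !normrX -/t (ger0_norm x0) !normr_nat /c.
    by set u := _^-1; set v := (_ * _)^-1; ring.
  apply: ler_wpM2l => //.
  have mle : `|moment m f x| <= moment m (fun y => `|f y|) x.
    apply: le_trans (norm_primitive Dx (L1_moment_integrand m x Lf)) _.
    apply: le_primitive => //; [exact/L1_norm/L1_moment_integrand|exact/L1_moment_integrand|].
    by move=> y yx; rewrite normrM normrX [ `|x ^+ 2 - _|]ger0_norm// xy0.
  by rewrite (le_trans (ler_wpM2r _ x1)) ?mul1r.
have Lg : L1 (fun y => expR (- (t / 2) * y ^+ 2) * `|f y|).
  by apply: L1_contM => //; exact: gauss_cont.
apply: (@le_trans _ _ (t * expR (t / 2 * x ^+ 2) *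
   primitive (fun y => expR (- (t / 2) * y ^+ 2) * `|f y|) x)).
  rewrite -primitiveZ//.
  have -> : \sum_(m < N) c m * moment m (fun y => `|f y|) x =
    primitive (fun y => \sum_(m < N) c m * ((x ^+ 2 - y ^+ 2) ^+ m * `|f y|)) x.
    rewrite (primitive_sum _ c
      (F := fun m y => (x ^+ 2 - y ^+ 2) ^+ m * `|f y|))// => m.
    exact: L1_moment_integrand.
  apply: le_primitive => //.
  - by apply: L1_sum => m; apply: L1Z; exact: L1_moment_integrand.
  - exact: L1Z.
  move=> y yx; under eq_bigr do rewrite mulrA.
  rewrite -big_distrl /= mulrA ler_wpM2r//.
  rewrite -[leRHS]mulrA -expRD mulNr -mulrBr.
  apply: le_trans (ler_wpM2l t0 (expsum_le N _)); last first.
    by rewrite mulr_ge0 ?divr_ge0 ?xy0.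
  rewrite /expsum big_distrr /=; apply: ler_sum => m _.
  rewrite /c [in leRHS]exprMn [in leRHS]exprMn exprVn exprS.
  rewrite [leLHS](_ : _ = t * t ^+ m * (2 ^+ m)^-1 * (m`!%:R)^-1 *
    (x ^+ 2 - y ^+ 2) ^+ m * (m.+1`!%:R)^-1); last first.
    by field; rewrite expf_neq0// !fact_neq0.
  rewrite [leRHS](_ : _ = t * t ^+ m * (2 ^+ m)^-1 * (m`!%:R)^-1 *
    (x ^+ 2 - y ^+ 2) ^+ m); last first.
    by field; rewrite expf_neq0// !fact_neq0.
  rewrite ler_piMr//.
    by rewrite !mulr_ge0 ?invr_ge0 ?exprn_ge0 ?xy0.
  by rewrite invf_le1 ?ltr0n ?fact_gt0// ler1n fact_gt0.
rewrite -mulrA [leRHS](_ : _ = t * (expR (t / 2 * x ^+ 2) *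
  (gaussnorm (- (t / 2)) * l2norm f))); last by ring.
rewrite ler_wpM2l// ler_wpM2l ?expR_ge0//.
have L2e : L2 (fun y => expR (- (t / 2) * y ^+ 2)) by exact/L2_cont/gauss_cont.
apply: (@le_trans _ _ (ip (fun y => expR (- (t / 2) * y ^+ 2)) (fun y => `|f y|))).
  apply: primitive_ndecr; [by []|exact: Lg|exact/I01P|].
  by move=> y _; rewrite mulr_ge0 ?expR_ge0.
apply: le_trans (ler_norm _) _; apply: le_trans (cauchy_schwarz L2e (L2_norm L2f)) _.
by rewrite l2norm_norm.
Qed.

Lemma expgen_sub_norm N s f : L2 f ->
  l2norm (fun x => expgen N.+1 s f x - f x) <= hsbound `|s| * l2norm f.
Proof.
move=> Lf; have L2e : L2 (fun x => expR (`|s| / 2 * x ^+ 2)).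
  exact/L2_cont/gauss_cont.
set c := `|s| * gaussnorm (- (`|s| / 2)) * l2norm f.
have c0 : 0 <= c by rewrite !mulr_ge0 ?l2norm_ge0.
have -> : hsbound `|s| * l2norm f = l2norm (fun x => c * expR (`|s| / 2 * x ^+ 2)).
  by rewrite l2normZ// (ger0_norm c0) /hsbound /c /gaussnorm; ring.
apply: le_l2norm; [exact/L2B/Lf/L2_expgen|exact: L2Z|].
by move=> x Dx; exact: expgen_sub_le.
Qed.

Lemma expgen_norm N s f : L2 f ->
  l2norm (expgen N.+1 s f) <= (1 + hsbound `|s|) * l2norm f.
Proof.
move=> Lf; rewrite mulrDl mul1r.
apply: le_trans (lerD (lexx _) (expgen_sub_norm N s Lf)).
apply: le_trans (l2norm_triangle Lf _); last exact/L2B/Lf/L2_expgen.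
by rewrite le_eqVlt; apply/orP; left; apply/eqP/eq_l2norm => x _; ring.
Qed.

(** Sum of the absolute values of the terms of total degree at least [N] in
    the product of two truncated exponentials of [t]; it tends to 0 because
    exp (2 t) = (exp t)^2. *)
Definition truncation_error N (t : R) : R := expsum N t ^+ 2 - expsum N (2 * t).

Lemma truncation_error_cvg t : truncation_error ^~ t @ \oo --> (0 : R).
Proof.
rewrite (_ : 0 = expR t * expR t - expR (2 * t)); last first.
  by rewrite -expRD mulr2n mulrDl mul1r subrr.
exact: cvgB (cvgM (@expsum_cvg R t) (@expsum_cvg R t)) (@expsum_cvg R (2 * t)).
Qed.

(** In the product of the truncations of exp (- s S) and exp (s S), the terms of
    total degree less than [N] add up to (s - s)^k / k! S^k, that is to the
    identity; S does not increase the norm, so the other terms are controlled by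
    the scalar [truncation_error]. *)
Lemma expgen_left_inverse N s f : L2 f ->
  l2norm (fun x => expgen N.+1 (- s) (expgen N.+1 s f) x - f x) <=
  truncation_error N.+1 `|s| * l2norm f.
Proof.
move=> L2f; have Lf := L2_L1 L2f.
pose F i j x := s ^+ i / i`!%:R * ((- s) ^+ j / j`!%:R * iter (i + j) gen f x).
pose rest x := \sum_(j < N.+1) \sum_(N.+1 - j <= i < N.+1) F i j x.
have L2F i j : L2 (F i j) by exact/L2Z/L2Z/L2_iter_gen.
have -> : l2norm (fun x => expgen N.+1 (- s) (expgen N.+1 s f) x - f x) = l2norm rest.
  apply: eq_l2norm => x Dx; rewrite /expgen.
  have -> : \sum_(j < N.+1) (- s) ^+ j / j`!%:R *
     iter j gen (fun x => \sum_(i < N.+1) s ^+ i / i`!%:R * iter i gen f x) x =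
     \sum_(j < N.+1) \sum_(0 <= i < N.+1) F i j x.
    apply: eq_bigr => j _; rewrite iter_gen_sum//; last first.
      by move=> i; exact/L1Z/L1_iter_gen.
    rewrite big_mkord big_distrr; apply: eq_bigr => i _ /=.
    rewrite iter_genZ//; last exact: L1_iter_gen.
    by rewrite -iterD addnC mulrCA.
  have -> : \sum_(j < N.+1) \sum_(0 <= i < N.+1) F i j x =
     \sum_(j < N.+1) \sum_(0 <= i < N.+1 - j) F i j x + rest x.
    rewrite -big_split; apply: eq_bigr => j _ /=.
    by rewrite (@big_cat_nat _ _ _ (N.+1 - j)) ?leq_subr.
  rewrite /F (exp_triangle s (- s) (fun n => iter n gen f x)) subrr.
  rewrite big_ord_recl /= expr0 fact0 divr1 mul1r big1; last first.
    by move=> k _; rewrite expr0n /= !mul0r.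
  by rewrite addr0 addrAC subrr add0r.
apply: le_trans (l2norm_sum _ _) _.
  by move=> j; exact: L2_sum.
have -> : truncation_error N.+1 `|s| * l2norm f = 
   \sum_(j < N.+1) \sum_(N.+1 - j <= i < N.+1)
     `|s| ^+ i / i`!%:R * (`|s| ^+ j / j`!%:R * l2norm f).
  have := exp_triangle `|s| `|s| (fun=> l2norm f) N.+1.
  rewrite -big_distrl /= -mulr2n -mulr_natl -/(expsum N.+1 (2 * `|s|)) => tri.
  rewrite /truncation_error mulrBl -tri.
  have -> : expsum N.+1 `|s| ^+ 2 * l2norm f = \sum_(j < N.+1)
     \sum_(0 <= i < N.+1) `|s| ^+ i / i`!%:R * (`|s| ^+ j / j`!%:R * l2norm f).
    rewrite expr2 -mulrA {2}/expsum [X in _ * X]mulr_suml mulr_sumr; apply: eq_bigr => j _.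
    by rewrite /expsum mulr_suml big_mkord.
  rewrite -sumrB; apply: eq_bigr => j _.
  rewrite (@big_cat_nat _ _ _ (N.+1 - j)) ?leq_subr//=.
  by rewrite addrAC subrr add0r.
apply: ler_sum => j _.
apply: le_trans (l2norm_sum _ _) _ => //.
apply: ler_sum => i _.
rewrite l2normZ; last exact/L2Z/L2_iter_gen.
rewrite l2normZ; last exact/L2_iter_gen.
rewrite !normrM !normfV !normr_nat !normrX normrN.
rewrite ler_wpM2l ?divr_ge0 ?exprn_ge0//.
rewrite ler_wpM2l ?divr_ge0 ?exprn_ge0//.
exact: l2norm_iter_gen.
Qed.

End Bounds.

(** * The error functions of the stability condition *)

Section ErrorFunctions.
Context {R : realType}.
Local Notation mu := (@lebesgue_measure R).
Local Notation D := (@I01 R).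

Lemma Rintegral_scale (G : R -> R) (a : R) : 0 < a -> continuous G ->
  \int[mu]_(x in `[0, a]) G x = a * \int[mu]_(x in D) G (a * x).
Proof.
move=> a0 cG; pose F x : R := a * x.
have dF x : is_derive x (1 : R) F a.
  by rewrite /F; apply: is_derive_eq; rewrite /GRing.scale /= mulr1.
have F' : derive1 F = cst a.
  by apply/funext => x; rewrite derive1E derive_val.
have cF : continuous F.
  by move=> x; apply: continuousM; [exact: cst_continuous|exact: cvg_id].
have := @integration_by_substitution_increasing R F G 0 1 ler01.
rewrite F' /F mulr0 mulr1 => H.
rewrite /Rintegral H.
- rewrite -RintegralZl//.
    by congr fine; apply: eq_integral => x _ /=; rewrite mulrC.
  apply: L1_cont; apply: within_cont => x.
  by apply: continuous_comp; [exact: cF|exact: cG].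
- by move=> x y _ _ xy; rewrite ltr_pM2l.
- by move=> x _; exact: cst_continuous.
- exact: is_cvg_cst.
- exact: is_cvg_cst.
- split; first by move=> x _; exact: ex_derive.
  + exact/cvg_at_right_filter/cF.
  + exact/cvg_at_left_filter/cF.
- exact: continuous_subspaceT.
Qed.

Lemma gaussnorm_sqr (r : R) :
  gaussnorm r ^+ 2 = \int[mu]_(x in D) expR (2 * r * x ^+ 2).
Proof.
rewrite l2norm_sqr; last exact/L2_cont/gauss_cont.
apply: eq_Rintegral => x _; rewrite -expRD; congr expR; ring.
Qed.

Lemma erfi_gaussnorm (t : R) : 0 < t ->
  erfi (Num.sqrt t) = 2 / Num.sqrt pi * Num.sqrt t * gaussnorm (t / 2) ^+ 2.
Proof.
move=> t0; rewrite /erfi Rintegral_scale ?sqrtr_gt0//; last first.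
  by move=> x; apply: continuous_comp; [exact: sqr_cont|exact: continuous_expR].
rewrite gaussnorm_sqr [LHS]mulrA; congr (_ * _); apply: eq_Rintegral => x _.
have -> : 2 * (t / 2) = t by field.
by rewrite exprMn sqr_sqrtr 1?ltW.
Qed.

Lemma erf_gaussnorm (t : R) : 0 < t ->
  erf (Num.sqrt t) = 2 / Num.sqrt pi * Num.sqrt t * gaussnorm (- (t / 2)) ^+ 2.
Proof.
move=> t0; rewrite /erf Rintegral_scale ?sqrtr_gt0//; last first.
  move=> x; apply: continuous_comp; last exact: continuous_expR.
  by apply: continuousN; exact: sqr_cont.
rewrite gaussnorm_sqr [LHS]mulrA; congr (_ * _); apply: eq_Rintegral => x _.
have -> : 2 * - (t / 2) = - t by field.
by rewrite exprMn sqr_sqrtr 1?ltW// mulNr.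
Qed.

(** After the change of variable xi = sqrt (c / 2) x, erfi and erf are, up to
    constants, the squared norms of the two Gaussian factors of [hsbound]. *)
Lemma hsboundE (c : R) : 0 < c ->
  Num.sqrt (c * pi / 8) * Num.sqrt (erfi (Num.sqrt (c / 2)))
    * Num.sqrt (erf (Num.sqrt (c / 2))) = hsbound (c / 2).
Proof.
move=> c0; have t0 : 0 < c / 2 by rewrite divr_gt0.
rewrite erfi_gaussnorm// erf_gaussnorm//; set t := c / 2.
have pi0 : 0 < pi :> R := pi_gt0 R.
have sp : Num.sqrt pi ^+ 2 = pi :> R by rewrite sqr_sqrtr ?ltW.
have st : Num.sqrt t ^+ 2 = t by rewrite sqr_sqrtr ?ltW.
have sp0 : 0 < Num.sqrt pi :> R by rewrite sqrtr_gt0.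
have st0 : 0 < Num.sqrt t by rewrite sqrtr_gt0.
have A0 : 0 <= gaussnorm (t / 2) by exact: l2norm_ge0.
have B0 : 0 <= gaussnorm (- (t / 2)) by exact: l2norm_ge0.
rewrite -[RHS]ger0_norm; last by rewrite !mulr_ge0// ltW.
rewrite -sqrtr_sqr -!sqrtrM ?mulr_ge0 ?invr_ge0 ?exprn_ge0 ?(ltW pi0)
  ?(ltW c0) ?(ltW sp0) ?(ltW st0)//.
congr Num.sqrt; rewrite /hsbound.
have -> : c = 2 * t by rewrite /t; field.
set A := gaussnorm _; set B := gaussnorm _.
set p := Num.sqrt pi in sp sp0 *; set q := Num.sqrt t in st st0 *.
rewrite -sp -st; field; rewrite gt_eqF//.
Qed.

End ErrorFunctions.

(** * Energy identities in space *)

Section Energy.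
Context {R : realType}.
Local Notation mu := (@lebesgue_measure R).
Local Notation D := (@I01 R).
Implicit Types f g h w v : R -> R.

Lemma H2_wderiv f fx fxx : H2 f fx fxx ->
  [/\ wderiv f fx, wderiv fx fxx & L2 fxx].
Proof.
move=> [L2xx Hx H]; have Hfx : wderiv fx fxx by split; [exact: L2_L1|exact: Hx].
by split; [split; [exact: wderiv_L1 Hfx|]|exact: Hfx|].
Qed.

Lemma ip_ae f g h : L2 f -> L2 g -> L2 h -> g = h %[ae mu in D] ->
  ip f g = ip f h.
Proof.
move=> Lf Lg Lh gh; rewrite /ip /Rintegral; congr fine.
apply: ae_eq_integral => //.
- exact: measurable_int (L2M Lf Lg).
- exact: measurable_int (L2M Lf Lh).
- by move: gh; apply: (@filterS _ _ (ae_filter_ringOfSetsType mu)) => x /= H Dx; rewrite H.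
Qed.

Lemma ip0r f : L2 f -> ip f (fun=> 0) = 0.
Proof.
move=> Lf; rewrite -[RHS](mul0r (ip f f)) -ipZr//; apply: eq_ip => // x _.
by rewrite mul0r.
Qed.

Lemma l2norm_ae0 f : L2 f -> f = (fun=> 0) %[ae mu in D] -> l2norm f = 0.
Proof.
move=> Lf f0; apply/eqP; rewrite -sqrf_eq0 l2norm_sqr//.
rewrite (ip_ae _ _ _ f0)//; last exact: L2_cst.
by rewrite ip0r.
Qed.

(** Only the condition at the left end is built in: at the right end the
    truncated transformation satisfies the Neumann condition up to a
    remainder, and the boundary term has to be kept. *)
Lemma green f fx fxx : wderiv f fx -> wderiv fx fxx -> L2 fxx -> fx 0 = 0 ->
  ip f fxx = f 1 * fx 1 - ip fx fx.
Proof.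
move=> Hf Hfx Lxx fx0; have := wderivE (wderivM Hf Hfx) I01_1.
have Lf := L2_wderiv Hf; have Lfx := L2_wderiv Hfx.
rewrite primitiveD//; [|exact: L2M..].
by rewrite fx0 mulr0 subr0 => <-; rewrite addrC addKr.
Qed.

(** Testing with v: gamma |v|^2 + |v'|^2 = beta <v, w>. *)
Lemma elliptic_bound gamma beta v vx vxx w : 0 < gamma -> L2 w -> H2 v vx vxx ->
  (fun=> 0) = (fun x => vxx x - gamma * v x + beta * w x) %[ae mu in D] ->
  vx 0 = 0 -> vx 1 = 0 -> l2norm v <= `|beta| / gamma * l2norm w.
Proof.
move=> g0 Lw /H2_wderiv[Hv Hvx Lxx] eqn vx0 vx1.
have Lv := L2_wderiv Hv; have Lvx := L2_wderiv Hvx.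
have Lgv := L2Z gamma Lv; have Lbw := L2Z beta Lw; have L1 := L2B Lxx Lgv.
have := ip_ae Lv (L2_cst 0) (L2D L1 Lbw) eqn.
rewrite ip0r// ipDr// ipBr// !ipZr// (green Hv Hvx)// vx1 mulr0 sub0r -(l2norm_sqr Lv) => H.
have Hc := le_trans (ler_norm _) (cauchy_schwarz Lv Lbw).
rewrite ipZr// l2normZ// in Hc.
have P := ip_ge0 vx.
have [v0|v0] := eqVneq (l2norm v) 0.
  by rewrite v0 mulr_ge0 ?divr_ge0 ?l2norm_ge0// ltW.
have vpos : 0 < l2norm v by rewrite lt_neqAle eq_sym v0 l2norm_ge0.
rewrite mulrAC ler_pdivlMr// -(ler_pM2l vpos) [l2norm v * (_ * gamma)]mulrA -expr2.
apply: le_trans Hc; lra.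
Qed.

(** Average f(1) = f(x) + int_x^1 f' over x. *)
Lemma trace_bound f fx : wderiv f fx -> L2 fx ->
  `|f 1| <= l2norm f + l2norm fx.
Proof.
move=> Hf Lfx; have Lf := L2_wderiv Hf.
have Lnf := L2_norm Lf.
have -> : `|f 1| = l2norm (fun=> f 1) by rewrite l2norm_cst.
apply: (@le_trans _ _ (l2norm (fun x => `|f x| + l2norm fx))).
  apply: le_l2norm; [exact: L2_cst|by apply: L2D => //; exact: L2_cst|].
  move=> x Dx.
  have -> : f 1 = f x + (primitive fx 1 - primitive fx x).
    by rewrite !(wderivE Hf)//; ring.
  rewrite (le_trans (ler_normD _ _))// lerD2l.
  have /I01P x01 := Dx; have [x0 x1] := andP x01.
  have LL := L1_norm (L2_L1 Lfx).
  rewrite primitive_itvB//; [|exact: L2_L1].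
  apply: le_trans (le_normr_Rintegral _ _) _ => //.
    apply: integrableS (L2_L1 Lfx) => // y /=.
    rewrite in_itv /= => /andP[xy y1]; apply/I01P.
    by rewrite (le_trans x0).
  rewrite -primitive_itvB//.
  apply: le_trans (primitive_le_l2norm Lfx I01_1).
  rewrite lerBlDr lerDl; apply: Rintegral_ge0 => //.
apply: le_trans (l2norm_triangle _ _) _ => //; first exact: L2_cst.
by rewrite l2norm_norm// l2norm_cst ger0_norm ?l2norm_ge0.
Qed.

(** Testing the equation of f = T_N w with f itself.  The commutator relation
    turns T_N w'' into f'' - 2 tau T_(N-1) w, where T_(N-1) w differs from f by
    the last term of the sum.  The boundary term f(1) f'(1) is small by the
    hypothesis on f'(1) and is absorbed by the dissipation - |f'|^2 through
    [trace_bound]. *)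
Lemma parabolic_energy N tau rho alpha eta w wx wxx wt v :
  0 <= tau -> 0 <= eta ->
  H2 w wx wxx -> wx 0 = 0 -> L2 wt -> L2 v ->
  wt = (fun x => wxx x - rho * w x + alpha * v x) %[ae mu in D] ->
  `|dexpgen N.+1 tau w wx 1| <= eta * l2norm w ->
  ip (expgen N.+1 tau w) (expgen N.+1 tau wt) <=
    - (2 * tau + rho) * l2norm (expgen N.+1 tau w) ^+ 2
    + (2 * tau * (tau ^+ N / N`!%:R) + eta) *
        (l2norm (expgen N.+1 tau w) * l2norm w)
    + eta ^+ 2 / 4 * l2norm w ^+ 2
    + `|alpha| * (l2norm (expgen N.+1 tau w) * l2norm (expgen N.+1 tau v)).
Proof.
move=> tau0 eta0 Hww wx0 Lwt Lv eqn bnd; have [Hw Hwx Lxx] := H2_wderiv Hww.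
set f := expgen N.+1 tau w.
have [Hf Hfx fx0] := expgen_wderiv2 N tau Hw Hwx wx0.
rewrite -/f in Hf; set fx := dexpgen _ _ _ _ in Hf Hfx fx0 bnd.
have Lw := L2_wderiv Hw; have Lf := L2_wderiv Hf; have Lfx := L2_wderiv Hfx.
have LTxx := L2_expgen N.+1 tau Lxx; have LTw := L2_expgen N tau Lw.
have LTv := L2_expgen N.+1 tau Lv.
have LTwt := L2_expgen N.+1 tau Lwt.
have Lrw := L2Z rho Lw; have Lav := L2Z alpha Lv.
have Lrf := L2Z rho Lf; have LaTv := L2Z alpha LTv.
pose r x := wxx x - rho * w x + alpha * v x.
have Lr : L2 r by apply: L2D => //; exact: L2B.
have -> : ip f (expgen N.+1 tau wt) = ip f (expgen N.+1 tau r).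
  have LTr := L2_expgen N.+1 tau Lr.
  apply/eqP; rewrite -subr_eq0 -ipBr// -normr_le0.
  apply: le_trans (cauchy_schwarz Lf (L2B LTwt LTr)) _.
  have Ld := L2B Lwt Lr.
  rewrite (_ : l2norm (fun _ => _ - _) = l2norm (expgen N.+1 tau (fun x => wt x - r x))).
    have d0 : l2norm (fun x => wt x - r x) = 0.
      apply: l2norm_ae0 => //; move: eqn.
      apply: (@filterS _ _ (ae_filter_ringOfSetsType mu)) => x /= H Dx.
      by rewrite H// subrr.
    have := expgen_norm N tau Ld; rewrite d0 mulr0 => H.
    by rewrite (le_trans (ler_wpM2l (l2norm_ge0 _) H))// mulr0.
  apply: eq_l2norm => x Dx.
  have L1r := L2_L1 Lr.
  have L1m := L1Z (-1) L1r.
  rewrite (@eq_expgen _ _ _ (fun x => wt x - r x) (fun x => wt x + -1 * r x))//.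
    by rewrite expgenD// ?expgenZ ?mulN1r//; exact: L2_L1.
  by move=> y _; rewrite mulN1r.
have -> : ip f (expgen N.+1 tau r) =
    ip f (expgen N.+1 tau wxx) - rho * ip f f + alpha * ip f (expgen N.+1 tau v).
  rewrite -!ipZr// -ipBr// -ipDr//; last exact: L2B.
  apply: eq_ip => // x Dx.
  have Lm := L1Z (- rho) (L2_L1 Lw).
  rewrite (@eq_expgen _ _ _ r (fun x => (wxx x + (- rho) * w x) + alpha * v x))//.
    rewrite expgenD ?expgenD ?expgenZ//; try exact: L2_L1.
      by rewrite mulNr.
    by apply: L1D => //; exact: L2_L1.
  by move=> y _; rewrite /r mulNr.
have L2tw := L2Z (2 * tau) LTw.
have -> : ip f (expgen N.+1 tau wxx) =
    ip f (fun x => expgen N.+1 tau wxx x + 2 * tau * expgen N tau w x) -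
    2 * tau * ip f (expgen N tau w).
  by rewrite ipDr// ipZr// addrK.
rewrite (green Hf Hfx)//; last exact: L2D.
have LiN := L2_iter_gen N Lw.
have -> : ip f (expgen N tau w) = ip f f - tau ^+ N / N`!%:R * ip f (iter N gen w).
  have LZ := L2Z (tau ^+ N / N`!%:R) LiN.
  rewrite -ipZr// -ipBr//; apply: eq_ip => // x Dx.
  by rewrite /f /expgen big_ord_recr /= addrK.
rewrite -!l2norm_sqr//.
have B1 : ip f (iter N gen w) <= l2norm f * l2norm w.
  apply: le_trans (ler_norm _) _; apply: le_trans (cauchy_schwarz Lf LiN) _.
  by rewrite ler_wpM2l ?l2norm_ge0 ?l2norm_iter_gen.
have B2 : alpha * ip f (expgen N.+1 tau v) <=
    `|alpha| * (l2norm f * l2norm (expgen N.+1 tau v)).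
  apply: le_trans (ler_norm _) _; rewrite normrM ler_wpM2l//.
  exact: cauchy_schwarz.
have B3 : f 1 * fx 1 <= (l2norm f + l2norm fx) * (eta * l2norm w).
  apply: le_trans (ler_norm _) _; rewrite normrM; apply: ler_pM => //.
  exact: trace_bound.
have B4 : 2 * tau * (tau ^+ N / N`!%:R) * ip f (iter N gen w) <=
    2 * tau * (tau ^+ N / N`!%:R) * (l2norm f * l2norm w).
  by rewrite ler_wpM2l// !mulr_ge0 ?invr_ge0 ?exprn_ge0.
(* Completing the square: eta |w| |f'| - |f'|^2 <= eta^2 |w|^2 / 4. *)
have B5 := sqr_ge0 (l2norm fx - eta / 2 * l2norm w).
move: B2 B3 B4 B5.
set a := l2norm f; set b := l2norm fx; set c := l2norm w; set d := _ / _`!%:R.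
set e := ip f (iter N gen w).
set p := alpha * _; set q := `|alpha| * _; set u := f 1 * fx 1.
move=> B2 B3 B4 B5.
nra.
Qed.

End Energy.

(** * The gain of the controller *)

Section PowerSeries.
Context {R : realType}.
Implicit Types (c : nat -> R) (x z a : R).

(** A class of coefficients stable under term-by-term differentiation whose
    power series converge everywhere. *)
Definition expbounded c : Prop := forall n, 0 <= c n <= n`!%:R^-1.

Definition psum c z : R := limn (pseries c z).

Lemma psum_cvg c z : expbounded c -> cvgn (pseries c z).
Proof.
move=> cb; apply: normed_cvg.
apply: (@series_le_cvg _ _ (exp_coeff `|z|)).
- by move=> n; exact: normr_ge0.
- by move=> n; exact: exp_coeff_ge0.
- move=> n; have /andP[c0 c1] := cb n.
  rewrite /= normrM normrX ger0_norm// /exp_coeff /= mulrC.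
  by apply: ler_wpM2l => //; exact: exprn_ge0.
- exact: is_cvg_series_exp_coeff.
Qed.

Lemma expbounded_diffs c : expbounded c -> expbounded (pseries_diffs c).
Proof.
move=> cb n; rewrite /pseries_diffs; have /andP[c0 c1] := cb n.+1.
rewrite mulr_ge0//=; apply: le_trans (ler_wpM2l _ c1) _ => //.
by rewrite factS natrM invfM mulrA divff ?mul1r// pnatr_eq0.
Qed.

Lemma psum_derive c z : expbounded c ->
  is_derive z (1 : R) (psum c) (psum (pseries_diffs c) z).
Proof.
move=> cb; apply: (@pseries_snd_diffs _ _ (`|z| + 1)).
- exact: psum_cvg.
- exact/psum_cvg/expbounded_diffs.
- exact/psum_cvg/expbounded_diffs/expbounded_diffs.
- by rewrite [ltRHS]ger0_norm ?addr_ge0// ltrDl.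
Qed.

Lemma psum_cont c : expbounded c -> continuous (psum c).
Proof.
move=> cb z; apply: differentiable_continuous; apply/derivable1_diffP.
by have := psum_derive z cb => -[].
Qed.

(** Nonnegative coefficients make the remainder increasing in z, so that the
    remainder at a bounds it uniformly on [0, a]. *)
Lemma psum_tail c z a n : expbounded c -> 0 <= z <= a ->
  `|psum c z - pseries c z n| <= psum c a - pseries c a n.
Proof.
move=> cb /andP[z0 za].
have Hle (u : nat -> R) m : (forall k, 0 <= u k) -> cvgn (series u) ->
    series u m <= limn (series u).
  move=> u0 cu; apply: nondecreasing_cvgn_le => //.
  by apply/nondecreasing_seqP => k; rewrite /series /= big_nat_recr//= lerDl.
have c0 k : 0 <= c k by case/andP: (cb k).
have Cz := @psum_cvg c z cb; have Ca := @psum_cvg c a cb.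
have H1 : pseries c z n <= psum c z.
  by apply: Hle => // k; rewrite mulr_ge0// exprn_ge0.
rewrite ger0_norm ?subr_ge0//.
(* The series of the c_k (a^k - z^k) has nonnegative terms. *)
suff : pseries c a n - pseries c z n <= psum c a - psum c z by lra.
rewrite [leLHS](_ : _ = series ((fun i => c i * a ^+ i) \- (fun i => c i * z ^+ i)) n); last first.
  by rewrite /pseries /series /= -sumrB.
rewrite [leRHS](_ : _ = limn (series
  ((fun i => c i * a ^+ i) \- (fun i => c i * z ^+ i)))); last first.
  by rewrite lim_seriesB.
apply: Hle.
  move=> k /=; rewrite -mulrBr mulr_ge0// subr_ge0 lerXn2r ?nnegrE//.
  exact: le_trans za.
exact: is_cvg_seriesB.
Qed.

Lemma psum_tail_cvg c a : expbounded c ->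
  psum c a - pseries c a n @[n --> \oo] --> (0 : R).
Proof.
move=> cb; rewrite -[X in _ --> X](subrr (psum c a)).
by apply: cvgB; [exact: cvg_cst|exact: psum_cvg].
Qed.

(** Taylor coefficients of z |-> I_1(2 sqrt z) / sqrt z. *)
Definition besselc (n : nat) : R := (n`!%:R * (n.+1)`!%:R)^-1.

Lemma besselc_expbounded : expbounded besselc.
Proof.
move=> n; rewrite /besselc invr_ge0 mulr_ge0//= invfM.
by rewrite ler_piMr// invf_le1 ?ltr0n ?ler1n fact_gt0.
Qed.

Lemma besselI1_quotient x : 0 < x ->
  besselI1 x / x = 2^-1 * psum besselc (x ^+ 2 / 4).
Proof.
move=> x0; rewrite /besselI1.
rewrite [X in series X](_ : _ = (x / 2) *: (fun n => besselc n * (x ^+ 2 / 4) ^+ n)).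
  rewrite lim_seriesZ; last exact: psum_cvg besselc_expbounded.
  rewrite /psum /pseries /GRing.scale /= mulrAC; congr (_ * _); field.
  by rewrite gt_eqF.
apply/funext => n; rewrite /= /GRing.scale /= /besselc.
rewrite exprS exprM; have -> : (x / 2) ^+ 2 = x ^+ 2 / 4 by field.
rewrite -[(x / 2) *: _]/(x / 2 * _).
set u := (_ * _)^-1; ring.
Qed.

End PowerSeries.

Section Control.
Context {R : realType}.
Local Notation mu := (@lebesgue_measure R).
Local Notation D := (@I01 R).
Implicit Types (w wx : R -> R) (x y : R).

(** Off the diagonal the kernel is x times an entire function of x^2 - y^2. *)
Lemma ka_psum (c2 : R) x y : 0 < c2 -> 0 <= y -> y < x ->
  ka c2 x y = - (c2 / 2) * (x * psum besselc (c2 / 4 * (x ^+ 2 - y ^+ 2))).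
Proof.
move=> c20 y0 yx; rewrite /ka gt_eqF//.
have d0 : 0 < c2 * (x ^+ 2 - y ^+ 2).
  by rewrite mulr_gt0// subr_gt0 ltrXn2r ?nnegrE// (le_trans y0)// ltW.
rewrite besselI1_quotient ?sqrtr_gt0// sqr_sqrtr 1?ltW//.
have -> : c2 * (x ^+ 2 - y ^+ 2) / 4 = c2 / 4 * (x ^+ 2 - y ^+ 2) by field.
by field.
Qed.

(** The opposite of the derivative in x of the kernel, at x = 1; it has a
    continuous extension to y = 1. *)
Definition gain (c2 y : R) : R :=
  c2 / 2 * psum besselc (c2 / 4 * (1 - y ^+ 2)) +
  (c2 / 2) ^+ 2 * psum (pseries_diffs besselc) (c2 / 4 * (1 - y ^+ 2)).

Lemma ka_psum_derive (c2 y : R) :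
  is_derive (1 : R) (1 : R)
    (fun x => - (c2 / 2) * (x * psum besselc (c2 / 4 * (x ^+ 2 - y ^+ 2))))
    (- gain c2 y).
Proof.
pose h x := c2 / 4 * (x ^+ 2 - y ^+ 2).
have H : is_derive (1 : R) (1 : R) h (c2 / 4 * 2).
  apply: is_derive_eq; rewrite /GRing.scale /=; ring.
have H2 := psum_derive (c2 / 4 * (1 ^+ 2 - y ^+ 2)) (@besselc_expbounded R).
have H3 := @is_derive1_comp R (psum besselc) h 1 _ _ H2 H.
apply: is_derive_eq.
by rewrite /GRing.scale /= /gain expr1n; field.
Qed.

Lemma ka_x_gain (c2 : R) y : 0 < c2 -> 0 <= y -> y < 1 -> ka_x c2 1 y = - gain c2 y.
Proof.
move=> c20 y0 y1; rewrite /ka_x derive1E.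
rewrite -(@derive_val _ _ _ _ _ _ _ (ka_psum_derive c2 y)).
apply: near_eq_derive; near=> z; apply: ka_psum => //.
near: z; exact: lt_nbhsr.
Unshelve. all: by end_near. Qed.

(** The part of [gain] that comes from the terms S, ..., S^(M+1) of the
    exponential; the terms of [dexpgen] at 1 involve consecutive powers of S,
    hence two partial sums of different lengths. *)
Definition gainsum (c2 : R) M (y : R) : R :=
  c2 / 2 * pseries besselc (c2 / 4 * (1 - y ^+ 2)) M.+1 +
  (c2 / 2) ^+ 2 * pseries (pseries_diffs besselc) (c2 / 4 * (1 - y ^+ 2)) M.

Definition gain_error (c2 : R) M : R :=
  c2 / 2 * (psum besselc (c2 / 4) - pseries besselc (c2 / 4) M.+1) +
  (c2 / 2) ^+ 2 * (psum (pseries_diffs besselc) (c2 / 4)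
                   - pseries (pseries_diffs besselc) (c2 / 4) M).

Lemma gain_tail (c2 : R) M y : 0 < c2 -> D y ->
  `|gain c2 y - gainsum c2 M y| <= gain_error c2 M.
Proof.
move=> c20 /I01P /andP[y0 y1]; set z := c2 / 4 * (1 - y ^+ 2).
have za : 0 <= z <= c2 / 4.
  rewrite mulr_ge0 ?divr_ge0 ?subr_ge0 ?expr_le1 ?(ltW c20)//=.
  by rewrite ler_piMr ?divr_ge0 ?(ltW c20)// lerBlDr lerDl sqr_ge0.
have t0 : 0 <= c2 / 2 by rewrite divr_ge0 ?ltW.
rewrite /gain /gainsum -/z.
rewrite (_ : _ - _ =
  c2 / 2 * (psum besselc z - pseries besselc z M.+1) +
  (c2 / 2) ^+ 2 * (psum (pseries_diffs besselc) z
                   - pseries (pseries_diffs besselc) z M)); last by ring.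
apply: le_trans (ler_normD _ _) _; 
rewrite normrM [ `|(c2 / 2) ^+ 2 * _|]normrM (ger0_norm t0).
rewrite (ger0_norm (exprn_ge0 2 t0)).
apply: lerD; apply: ler_wpM2l; rewrite ?exprn_ge0//; apply: psum_tail => //.
  exact: besselc_expbounded.
exact/expbounded_diffs/besselc_expbounded.
Qed.

Lemma gain_error_cvg (c2 : R) : gain_error c2 @ \oo --> (0 : R).
Proof.
have H1 := @psum_tail_cvg R _ (c2 / 4) (@besselc_expbounded R).
have H2 := @psum_tail_cvg R _ (c2 / 4) (expbounded_diffs (@besselc_expbounded R)).
rewrite -cvg_shiftS in H1.
rewrite [X in _ --> X](_ : _ = c2 / 2 * 0 + (c2 / 2) ^+ 2 * 0); last by ring.
apply: cvgD; apply: cvgM; [exact: cvg_cst|exact: H1|exact: cvg_cst|exact: H2].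
Qed.

Lemma one_sqr_cont (c2 : R) : continuous (fun y : R => c2 / 4 * (1 - y ^+ 2)).
Proof.
move=> y; apply: cvgM; first exact: cvg_cst.
by apply: cvgB; [exact: cvg_cst|exact: sqr_cont].
Qed.

Lemma gain_cont (c2 : R) : {within D, continuous (gain c2)}.
Proof.
apply: within_cont => y; have H := one_sqr_cont (c2 := c2) (x := y).
apply: cvgD; apply: cvgM; try exact: cvg_cst.
  by apply: (continuous_comp H); apply: psum_cont; exact: besselc_expbounded.
apply: (continuous_comp H); apply: psum_cont.
exact/expbounded_diffs/besselc_expbounded.
Qed.

(** The derivative of the kernel is only known for y < 1, which is enough as a
    point is negligible. *)
Lemma control_integral (c2 : R) w : 0 < c2 -> L1 w ->
  \int[mu]_(y in D) (ka_x c2 1 y * w y) = - primitive (fun y => gain c2 y * w y) 1.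
Proof.
move=> c20 Lw; have Lgw := L1_contM (gain_cont (c2 := c2)) Lw.
have LZ := L1Z (-1) Lgw.
rewrite -mulN1r -primitiveZ//.
have sub : `[0, 1[ `<=` D.
  by move=> y /=; rewrite in_itv /= => /andP[y0 y1]; apply/I01P; rewrite y0 ltW.
have Lo : mu.-integrable `[0, 1[ (EFin \o (fun y => -1 * (gain c2 y * w y))).
  by apply: integrableS LZ.
have E y : `[0, 1[%classic y -> -1 * (gain c2 y * w y) = ka_x c2 1 y * w y.
  by rewrite /= in_itv /= => /andP[y0 y1]; rewrite ka_x_gain// mulN1r mulNr.
rewrite /I01 /primitive -!Rintegral_itv_bndo_bndc//.
  by apply: eq_Rintegral => y /set_mem /E ->.
by apply: eq_integrable Lo => // y /set_mem /E /= ->.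
Qed.

Lemma gainsumM (c2 : R) M w y : gainsum c2 M y * w y =
  \sum_(m < M.+1) c2 / 2 * besselc m * (c2 / 4) ^+ m *
    ((1 ^+ 2 - y ^+ 2) ^+ m * w y) +
  \sum_(m < M) (c2 / 2) ^+ 2 * pseries_diffs besselc m * (c2 / 4) ^+ m *
    ((1 ^+ 2 - y ^+ 2) ^+ m * w y).
Proof.
rewrite /gainsum /pseries /series /= !big_mkord mulrDl expr1n.
rewrite !mulr_sumr !mulr_suml.
by congr (_ + _); apply: eq_bigr => m _; rewrite [(c2 / 4 * _) ^+ m]exprMn; ring.
Qed.

Lemma L1_gainsumM (c2 : R) M w : L1 w -> L1 (fun y => gainsum c2 M y * w y).
Proof.
move=> Lw; have Lm m := L1_moment_integrand m 1 Lw.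
apply: eq_L1; first by move=> y _; rewrite gainsumM.
by apply: L1D; apply: L1_sum => m; exact: L1Z.
Qed.

(** The derivative of S^(m+1) w at 1 is S^(m+1) w (1) + S^m w (1), and
    [iter_gen_moment] expresses both as integrals of w; only S^0 w (1) = w(1) is
    left over, and its coefficient is the opposite of k^a(1,1). *)
Lemma boundary_expansion (c2 : R) M w wx : L1 w ->
  dexpgen M.+2 (c2 / 2) w wx 1 =
  wx 1 + c2 / 2 * w 1 + primitive (fun y => gainsum c2 M y * w y) 1.
Proof.
move=> Lw; set t := c2 / 2; have D1 : D (1 : R) by exact: I01_1.
have fact_neq0 n : (n`!%:R != 0 :> R) by rewrite pnatr_eq0 -lt0n fact_gt0.
have gen1 m : iter m.+1 gen w 1 = (2 ^+ m * m`!%:R)^-1 * moment m w 1.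
  by rewrite iter_gen_moment// div1r.
have Lm m := L1_moment_integrand m 1 Lw.
have -> : primitive (fun y => gainsum c2 M y * w y) 1 =
    \sum_(m < M.+1) t * besselc m * (c2 / 4) ^+ m * moment m w 1 +
    \sum_(m < M) t ^+ 2 * pseries_diffs besselc m * (c2 / 4) ^+ m * moment m w 1.
  rewrite (eq_primitive _ (fun y _ => gainsumM c2 M w y))//.
  rewrite primitiveD//; [|by apply: L1_sum => m; exact: L1Z..].
  rewrite (primitive_sum _ (fun m => c2 / 2 * besselc m * (c2 / 4) ^+ m)
    (F := fun m y => (1 ^+ 2 - y ^+ 2) ^+ m * w y))//.
  by rewrite (primitive_sum _
    (fun m => (c2 / 2) ^+ 2 * pseries_diffs besselc m * (c2 / 4) ^+ m)
    (F := fun m y => (1 ^+ 2 - y ^+ 2) ^+ m * w y)).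
rewrite /dexpgen big_ord_recl /= expr0 fact0 divr1 mul1r -addrA; congr (_ + _).
under eq_bigr do rewrite /bump /= add1n mul1r mulrDr.
rewrite big_split /= addrC big_ord_recl /= expr1 divr1 -addrA; congr (_ + _).
rewrite addrC; congr (_ + _); apply: eq_bigr => m _.
  have -> : primitive (iter m gen w) 1 = iter m.+1 gen w 1.
    by rewrite /= /gen mul1r.
  rewrite gen1 mulrA; congr (_ * _); rewrite /besselc.
  have -> : c2 / 4 = t / 2 by rewrite /t; field.
  clearbody t; rewrite expr_div_n exprS; field.
  by rewrite expf_neq0// !fact_neq0.
rewrite /bump /= add1n -/(iter m.+1 gen w) gen1 mulrA; congr (_ * _).
rewrite /pseries_diffs /besselc.
have -> : c2 / 4 = t / 2 by rewrite /t; field.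
clearbody t; rewrite expr_div_n !exprS.
have -> : (m.+1)`!%:R = m.+1%:R * m`!%:R :> R by rewrite factS natrM.
by field; rewrite nat1r expf_neq0// !fact_neq0//=.
Qed.

(** The feedback law cancels w'(1), the term w(1) and the full series of the
    gain, leaving the tail of that series. *)
Lemma boundary_bound (c2 : R) M (w : R -> R -> R) wx t : 0 < c2 -> L2 (w t) ->
  wx 1 = control c2 w t ->
  `|dexpgen M.+2 (c2 / 2) (w t) wx 1| <= gain_error c2 M * l2norm (w t).
Proof.
move=> c20 L2w; have Lw := L2_L1 L2w.
rewrite boundary_expansion// /control control_integral// => ->.
rewrite /ka eqxx.
have Lg := L1_contM (gain_cont (c2 := c2)) Lw.
have Ls := L1_gainsumM c2 M Lw.
rewrite (_ : _ + _ = primitive (fun y => gainsum c2 M y * w t y - gain c2 y * w t y) 1).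
  apply: le_trans (norm_primitive I01_1 (L1B Ls Lg)) _.
  have e0 : 0 <= gain_error c2 M by exact: le_trans (gain_tail M c20 I01_0).
  apply: (@le_trans _ _ (primitive (fun y => gain_error c2 M * `|w t y|) 1)).
    apply: le_primitive; [exact: I01_1|exact/L1_norm/L1B|exact/L1Z/L1_norm|].
    move=> y /I01P Dy; rewrite -mulrBl normrM distrC ler_wpM2r//.
    exact: gain_tail.
  rewrite primitiveZ//; last exact: L1_norm.
  by rewrite ler_wpM2l// primitive_le_l2norm.
by rewrite primitiveB//; field.
Qed.

End Control.

(** * Trajectories in L2(0,1) *)

Section Trajectories.
Context {R : realType}.
Local Notation D := (@I01 R).
Implicit Types (f g : R -> R) (z : R -> R -> R).

Lemma l2norm_lipschitz f g : L2 f -> L2 g ->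
  `|l2norm f - l2norm g| <= l2norm (fun x => f x - g x).
Proof.
move=> Lf Lg; have Ld := L2B Lf Lg; have Ld' := L2B Lg Lf.
have H1 : l2norm f <= l2norm (fun x => f x - g x) + l2norm g.
  rewrite -(eq_l2norm (f := fun x => f x - g x + g x)); last by move=> x _; rewrite subrK.
  exact: l2norm_triangle.
have H2 : l2norm g <= l2norm (fun x => f x - g x) + l2norm f.
  rewrite l2norm_distrC// -(eq_l2norm (f := fun x => g x - f x + f x)); last first.
    by move=> x _; rewrite subrK.
  exact: l2norm_triangle.
by rewrite ler_norml; apply/andP; split; lra.
Qed.

Lemma l2norm_sqrDZ f g (r : R) : L2 f -> L2 g ->
  l2norm (fun x => f x + r * g x) ^+ 2 =
  l2norm f ^+ 2 + 2 * r * ip f g + r ^+ 2 * l2norm g ^+ 2.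
Proof.
move=> Lf Lg; have Lrg := L2Z r Lg; have Ls := L2D Lf Lrg.
rewrite !l2norm_sqr// ipDl// !ipDr// !ipZl// !ipZr// [ip g f]ipC.
by ring.
Qed.

Lemma L2_derivative_expgen N s z zt t : 0 < t -> (forall u, 0 <= u -> L2 (z u)) ->
  L2_derivative_at z t zt ->
  L2_derivative_at (fun u => expgen N.+1 s (z u)) t (expgen N.+1 s zt).
Proof.
move=> t0 Lz [Lzt H]; split; first exact: L2_expgen.
have H' : (1 + hsbound `|s|) *
    l2norm (fun x => (z (t + h) x - z t x) / h - zt x) @[h --> 0^'] --> (0 : R).
  by rewrite -[X in _ --> X](mulr0 (1 + hsbound `|s|)); apply: cvgM; [exact: cvg_cst|exact: H].
apply: squeeze_cvgr (@cvg_cst _ (0 : R) _ _ _) H'.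
near=> h; rewrite l2norm_ge0 /=.
have th : 0 <= t + h.
  suff : - t < h by lra.
  by near: h; apply: nbhs_dnbhs; apply: lt_nbhsr; rewrite oppr_lt0.
have Lt := Lz _ (ltW t0); have Lth := Lz _ th.
have Lq := L2Z h^-1 (L2B Lth Lt).
have Lr : L2 (fun x => (z (t + h) x - z t x) / h - zt x).
  by apply: eq_L2 (L2B Lq Lzt) => x _; rewrite mulrC.
apply: le_trans (expgen_norm N s Lr); rewrite le_eqVlt; apply/orP; left.
apply/eqP/eq_l2norm => x Dx.
have L1th := L2_L1 Lth; have L1t := L1Z (-1) (L2_L1 Lt).
have L1zt := L1Z (-1) (L2_L1 Lzt).
rewrite (@eq_expgen _ _ _ (fun x => (z (t + h) x - z t x) / h - zt x)
  (fun x => h^-1 * (z (t + h) x + -1 * z t x) + -1 * zt x))//; last first.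
  by move=> y _; ring.
rewrite expgenD//; last by apply: L1Z; exact: L1D.
rewrite expgenZ//; last exact: L1D.
rewrite expgenD// !expgenZ//; try exact: L2_L1.
by ring.
Unshelve. all: by end_near. Qed.

Lemma L2_continuous_expgen N s z t : 0 <= t -> (forall u, 0 <= u -> L2 (z u)) ->
  L2_continuous_at z t -> L2_continuous_at (fun u => expgen N.+1 s (z u)) t.
Proof.
move=> t0 Lz H; rewrite /L2_continuous_at.
have H' : (1 + hsbound `|s|) * l2norm (fun x => z u x - z t x)
    @[u --> within [set s | 0 <= s] (nbhs t)] --> (0 : R).
  by rewrite -[X in _ --> X](mulr0 (1 + hsbound `|s|)); apply: cvgM; [exact: cvg_cst|exact: H].
apply: squeeze_cvgr (@cvg_cst _ (0 : R) _ _ _) H'.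
near=> u; rewrite l2norm_ge0 /=.
have u0 : 0 <= u by near: u; exact: withinT.
have Lt := Lz _ t0; have Lu := Lz _ u0.
apply: le_trans (expgen_norm N s (L2B Lu Lt)); rewrite le_eqVlt; apply/orP; left.
apply/eqP/eq_l2norm => x Dx.
have L1t := L1Z (-1) (L2_L1 Lt).
rewrite (@eq_expgen _ _ _ (fun x => z u x - z t x) (fun x => z u x + -1 * z t x))//; last first.
  by move=> y _; ring.
rewrite expgenD// ?expgenZ//; try exact: L2_L1.
by ring.
Unshelve. all: by end_near. Qed.

(** With q = (z(t+h) - z(t)) / h, the difference quotient of the squared norm
    is 2 <z(t), q> + h |q|^2. *)
Lemma l2norm_sqr_derive z zt t : 0 < t -> (forall u, 0 <= u -> L2 (z u)) ->
  L2_derivative_at z t zt ->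
  is_derive t (1 : R) (fun u => l2norm (z u) ^+ 2) (2 * ip (z t) zt).
Proof.
move=> t0 Lz [Lzt H].
set V := fun u => _.
suff dV : h^-1 *: (V (h + t) - V t) @[h --> 0^'] --> 2 * ip (z t) zt.
  have F : derive1 V t = 2 * ip (z t) zt by apply: cvg_lim dV.
  have Df : derivable V t 1.
    move: dV; rewrite /derivable [X in X @ 0^'](_ : _ =
        (fun h => h^-1 *: (V (h%:A + t) - V t))) /=; last first.
      by apply/funext => i //=; rewrite [i%:A]mulr1.
    by move=> /(cvg_lim _) -> //.
  by constructor; [exact: Df|rewrite -derive1E].
pose e h := l2norm (fun x => (z (t + h) x - z t x) / h - zt x).
have He : e h @[h --> 0^'] --> (0 : R) := H.
(* B h bounds the error of the difference quotient, as |q| <= |zt| + e h. *)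
pose B h := 2 * (e h * l2norm (z t)) + `|h| * (l2norm zt + e h) ^+ 2.
have HB : B h @[h --> 0^'] --> (0 : R).
  rewrite [X in _ --> X](_ : _ = 2 * (0 * l2norm (z t)) +
    `|0 : R| * ((l2norm zt + 0) * (l2norm zt + 0))); last first.
    by rewrite normr0 !mul0r mulr0 addr0.
  have Hs : l2norm zt + e h @[h --> 0^'] --> l2norm zt + 0.
    by apply: cvgD => //; exact: cvg_cst.
  apply: cvgD; apply: cvgM; [exact: cvg_cst|by apply: cvgM => //; exact: cvg_cst| |exact: cvgM].
  by apply: cvg_norm; apply: cvg_within_filter; exact: cvg_id.
apply/cvgrPdist_le => eps eps0; near=> h.
have hB : `|B h| <= eps by near: h; apply: cvgr0_norm_le => //; exact: HB.
have h0 : h != 0 by near: h; exact: nbhs_dnbhs_neq.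
have th : 0 <= t + h.
  suff : - t < h by lra.
  by near: h; apply: nbhs_dnbhs; apply: lt_nbhsr; rewrite oppr_lt0.
apply: le_trans hB; rewrite distrC; apply: le_trans (ler_norm _).
have Lt := Lz _ (ltW t0); have Lth := Lz _ th.
pose q x := h^-1 * (z (t + h) x - z t x).
have Lq : L2 q by exact/L2Z/L2B.
pose r x := (z (t + h) x - z t x) / h - zt x.
have Lr : L2 r by apply: eq_L2 (L2B Lq Lzt) => x _; rewrite /q mulrC.
have Lhq := L2Z h Lq.
have E1 : V (h + t) = V t + 2 * h * ip (z t) q + h ^+ 2 * l2norm q ^+ 2.
  rewrite /V [h + t]addrC.
  rewrite (eq_l2norm (g := fun x => z t x + h * q x)); last first.
    by move=> x _; rewrite /q mulrA divff// mul1r; ring.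
  by rewrite l2norm_sqrDZ// !exprMn.
have E2 : ip (z t) q = ip (z t) zt + ip (z t) r.
  by rewrite -ipDr//; apply: eq_ip => // x _; rewrite /q /r; ring.
have E3 : h^-1 *: (V (h + t) - V t) - 2 * ip (z t) zt =
    2 * ip (z t) r + h * l2norm q ^+ 2.
  by rewrite /GRing.scale /= E1 E2; field.
rewrite E3; apply: le_trans (ler_normD _ _) _; rewrite /B.
apply: lerD; rewrite normrM.
  by rewrite normr_nat ler_wpM2l// mulrC; apply: le_trans (cauchy_schwarz Lt Lr) _; rewrite mulrC.
apply: ler_wpM2l => //; rewrite normrX ger0_norm ?l2norm_ge0//.
rewrite lerXn2r ?nnegrE ?addr_ge0 ?l2norm_ge0//.
apply: le_trans (l2norm_triangle Lzt Lr); rewrite le_eqVlt; apply/orP; left.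
by apply/eqP/eq_l2norm => x _; rewrite /q /r; ring.
Unshelve. all: by end_near. Qed.

Lemma l2norm_within_continuous z b :
  (forall u, 0 <= u -> L2 (z u)) -> (forall t, 0 <= t -> L2_continuous_at z t) ->
  {within `[0, b], continuous (fun u => l2norm (z u))}.
Proof.
move=> Lz Hz; apply/subspace_continuousP => t; rewrite /= in_itv /= => /andP[t0 tb].
apply/cvgrPdist_le => eps eps0.
have H : l2norm (fun x => z u x - z t x) @[u --> within [set s | 0 <= s] (nbhs t)]
    --> (0 : R) := Hz t t0.
have := cvgr0_norm_le _ H _ eps0; rewrite !near_withinE.
move=> /(_ (within_filter _ _)); apply: filterS => u Hu /=; rewrite in_itv /= => /andP[u0 _].
rewrite distrC; apply: le_trans (l2norm_lipschitz _ _) _; [exact: Lz..|].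
by rewrite -[leLHS]ger0_norm ?l2norm_ge0//; exact: Hu.
Qed.

(** The Gronwall argument: exp (k s) V(s) is nonincreasing.  The differential
    inequality is only available for positive times, so continuity at 0 enters
    separately. *)
Lemma exp_decay (V dV : R -> R) (k t : R) : 0 <= t ->
  {within `[0, t], continuous V} ->
  (forall s : R, 0 < s -> is_derive s (1 : R) V (dV s)) ->
  (forall s : R, 0 < s -> dV s <= - k * V s) ->
  V t <= expR (- k * t) * V 0.
Proof.
move=> t0 cV dVE dVle; pose g (s : R) := expR (k * s) * V s.
have dg (s : R) : 0 < s -> is_derive s (1 : R) g (expR (k * s) * (k * V s + dV s)).
  move=> s0; have H := dVE s s0.
  rewrite /g; apply: is_derive_eq; rewrite /GRing.scale /=; ring.
have gle : g t <= g 0.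
  apply: (@ler0_derive1_nincr _ g 0 t) => //.
  - by move=> s; rewrite in_itv /= => /andP[s0 _]; have [] := dg s s0.
  - move=> s; rewrite in_itv /= => /andP[s0 _].
    rewrite derive1E (@derive_val _ _ _ _ _ _ _ (dg s s0)).
    rewrite mulr_ge0_le0 ?expR_ge0//.
    by have := dVle s s0; lra.
  - move=> s; apply: cvgM; last exact: cV.
    apply: continuous_subspaceT => u.
    apply: continuous_comp; last exact: continuous_expR.
    by apply: cvgM; [exact: cvg_cst|exact: cvg_id].
move: gle; rewrite /g mulr0 expR0 mul1r mulNr expRN => gle.
by rewrite -ler_pdivrMl ?invr_gt0 ?expR_gt0// invrK.
Qed.


End Trajectories.

(** * Exponential stability *)

Section Stability.
Context {R : realType}.

Definition inverse_bound (tau : R) M : R :=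
  (1 + hsbound tau) / (1 - truncation_error M.+2 tau).

(** The rate that [parabolic_energy] yields once |w| <= C |T w|,
    |v| <= kappa |w| and |T v| <= (1 + K) |v| have been inserted; [eta] bounds
    the boundary remainder and [eps] is the last coefficient of the truncated
    exponential. *)
Definition decay_rate (tau rho alpha kappa eta eps C K : R) : R :=
  2 * tau + rho - (2 * tau * eps + eta) * C - eta ^+ 2 / 4 * C ^+ 2
  - `|alpha| * (1 + K) * kappa * C.

Lemma hsbound_ge0 (t : R) : 0 <= t -> 0 <= hsbound t.
Proof. by move=> t0; rewrite !mulr_ge0 ?l2norm_ge0. Qed.

(** An approximate left inverse whose defect has norm less than 1 bounds w by
    T w. *)
Lemma inverse_norm (tau : R) M f : 0 <= tau -> truncation_error M.+2 tau < 1 ->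
  L2 f -> l2norm f <= inverse_bound tau M * l2norm (expgen M.+2 tau f).
Proof.
move=> t0 te Lf; set g := expgen M.+2 tau f.
have Lg : L2 g by exact: L2_expgen.
have LEg := L2_expgen M.+2 (- tau) Lg.
have H1 := expgen_norm M.+1 (- tau) Lg.
have H2 := expgen_left_inverse M.+1 tau Lf.
rewrite normrN ger0_norm// in H1; rewrite ger0_norm// -/g in H2.
have H3 : l2norm f <= l2norm (expgen M.+2 (- tau) g) +
    l2norm (fun x => expgen M.+2 (- tau) g x - f x).
  rewrite l2norm_distrC//.
  rewrite -(eq_l2norm (f := fun x => expgen M.+2 (- tau) g x + (f x - expgen M.+2 (- tau) g x))).
    by apply: l2norm_triangle => //; exact: L2B.
  by move=> x _; ring.
rewrite /inverse_bound mulrAC ler_pdivlMr ?subr_gt0//.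
by have := l2norm_ge0 f; lra.
Qed.

(** As M grows, [decay_rate] tends to
    c2 + rho - |alpha| kappa (1 + hsbound)^2, which the stability condition makes
    positive. *)
Lemma small_truncation (rho alpha kappa c2 : R) : 0 < c2 -> 0 <= kappa ->
  `|alpha| * kappa * (1 + hsbound (c2 / 2)) ^+ 2 < c2 + rho ->
  exists M delta, [/\ truncation_error M.+2 (c2 / 2) < 1, 0 < delta &
    delta <= decay_rate (c2 / 2) rho alpha kappa (gain_error c2 M)
      ((c2 / 2) ^+ M.+1 / (M.+1)`!%:R) (inverse_bound (c2 / 2) M) (hsbound (c2 / 2))].
Proof.
move=> c20 k0 hs; set t := c2 / 2; set K := hsbound t.
pose L := c2 + rho - `|alpha| * kappa * (1 + K) ^+ 2.
have L0 : 0 < L by rewrite subr_gt0.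
have T : truncation_error M.+2 t @[M --> \oo] --> (0 : R).
  have := @truncation_error_cvg R t; rewrite -cvg_shiftS => H.
  by rewrite -cvg_shiftS in H.
have C : inverse_bound t M @[M --> \oo] --> 1 + K.
  rewrite [X in _ --> X](_ : _ = (1 + K) * (1 - 0)^-1); last by rewrite subr0 invr1 mulr1.
  apply: cvgM; first exact: cvg_cst.
  by apply: cvgV; [rewrite subr0 oner_neq0|apply: cvgB; [exact: cvg_cst|exact: T]].
have G := @gain_error_cvg R c2.
have E : t ^+ M.+1 / (M.+1)`!%:R @[M --> \oo] --> (0 : R).
  by have := @cvg_exp_coeff R t; rewrite -cvg_shiftS.
have H : decay_rate t rho alpha kappa (gain_error c2 M) (t ^+ M.+1 / (M.+1)`!%:R)
    (inverse_bound t M) K @[M --> \oo] --> L.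
  rewrite [X in _ --> X](_ : _ = 2 * t + rho - (2 * t * 0 + 0) * (1 + K)
    - (0 * 0) * 4^-1 * ((1 + K) * (1 + K)) - `|alpha| * (1 + K) * kappa * (1 + K)); last first.
    by rewrite /L /t; field.
  rewrite /decay_rate; apply: cvgB; last by apply: cvgM; [exact: cvg_cst|exact: C].
  apply: cvgB.
    apply: cvgB; first exact: cvg_cst.
    apply: cvgM C; apply: cvgD; last exact: G.
    by apply: cvgM; [exact: cvg_cst|exact: E].
  apply: cvgM; last exact: (cvgM C C).
  by apply: cvgM; [exact: (cvgM G G)|exact: cvg_cst].
have N1 := cvgr_lt 0 T 1 ltr01.
have Lhalf : L / 2 < L by rewrite ltr_pdivrMr// ltr_pMr// ltr1n.
have N2 := cvgr_ge L H (L / 2) Lhalf.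
(* Any rate below the limit L is eventually exceeded; L / 2 is chosen. *)
have [M [MT MH]] := filter_ex (filterI (N1 _) (N2 _)).
by exists M, (L / 2); split => //; rewrite divr_gt0.
Qed.

(** The quantity that decays is the norm of the transformed state, with
    constant 1; this gives a constant for w itself that is uniform over all
    trajectories. *)
Lemma energy_decay (rho alpha beta gamma c2 delta : R) M w v :
  0 < gamma -> 0 < c2 ->
  truncation_error M.+2 (c2 / 2) < 1 ->
  delta <= decay_rate (c2 / 2) rho alpha (`|beta| / gamma) (gain_error c2 M)
      ((c2 / 2) ^+ M.+1 / (M.+1)`!%:R) (inverse_bound (c2 / 2) M)
      (hsbound (c2 / 2)) ->
  is_solution rho alpha beta gamma (control c2 w) w v ->
  forall t, 0 <= t ->
    l2norm (expgen M.+2 (c2 / 2) (w t)) <=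
    expR (- delta * t) * l2norm (expgen M.+2 (c2 / 2) (w 0)).
Proof.
move=> g0 c20 te dle [Lw cw dw ev] t t0.
set s := c2 / 2; have s0 : 0 <= s by rewrite divr_ge0// ltW.
have Lz u : 0 <= u -> L2 (expgen M.+2 s (w u)).
  by move=> u0; apply: L2_expgen; exact: Lw.
have eta0 : 0 <= gain_error c2 M by exact: le_trans (gain_tail M c20 I01_0).
have K0 := hsbound_ge0 s0.
pose V u := l2norm (expgen M.+2 s (w u)) ^+ 2.
have [dV HdV] : exists dV : R -> R, forall u : R, 0 < u ->
    is_derive u (1 : R) V (dV u) /\ dV u <= - (2 * delta) * V u.
  suff : forall u : R, exists d : R, 0 < u -> is_derive u (1 : R) V d /\ d <= - (2 * delta) * V u.
    by move=> /choice[f Hf]; exists f.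
  move=> u; have [u0|u0] := ltP 0 u; last by exists 0.
  have [wt [wx [wxx [dwt Hw eqn wx0 wx1]]]] := dw u u0.
  have [vx [vxx [Hv eqv vx0 vx1]]] := ev u (ltW u0).
  have [Hv1 _ _] := H2_wderiv Hv; have Lv := L2_wderiv Hv1.
  have Lwu := Lw u (ltW u0); have Lwt := dwt.1.
  have vle := elliptic_bound g0 Lwu Hv eqv vx0 vx1.
  have bnd := boundary_bound M c20 Lwu wx1.
  have en := parabolic_energy s0 eta0 Hw wx0 Lwt Lv eqn bnd.
  have wle := inverse_norm s0 te Lwu.
  have Tv := expgen_norm M.+1 s Lv; rewrite (ger0_norm s0) in Tv.
  exists (2 * ip (expgen M.+2 s (w u)) (expgen M.+2 s wt)) => _; split.
    apply: l2norm_sqr_derive => //.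
    exact: L2_derivative_expgen.
  rewrite mulNr -mulrA -mulrN ler_wpM2l//; apply: le_trans en _.
  rewrite /V; move: dle; rewrite /decay_rate -/s.
  set C := inverse_bound _ _ in wle *; set K := hsbound _ in K0 Tv *.
  set ep := _ / _`!%:R; set eta := gain_error _ _ in eta0 *.
  set a := l2norm (expgen M.+2 s (w u)) in wle *.
  set b := l2norm (w u) in wle vle *.
  set y := l2norm (expgen M.+2 s (v u)) in Tv *.
  have a0 : 0 <= a by exact: l2norm_ge0.
  have b0 : 0 <= b by exact: l2norm_ge0.
  have ep0 : 0 <= ep by rewrite divr_ge0// exprn_ge0.
  set kappa := _ / gamma in vle *.
  have yle : y <= (1 + K) * (kappa * (C * a)).
    apply: le_trans Tv _; rewrite ler_wpM2l ?addr_ge0//.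
    apply: le_trans vle _; apply: ler_wpM2l => //.
    by rewrite divr_ge0// ltW.
  have T1 : (2 * s * ep + eta) * (a * b) <= (2 * s * ep + eta) * (a * (C * a)).
    by apply: ler_wpM2l; [by rewrite addr_ge0 ?(mulr_ge0 (mulr_ge0 _ s0) ep0)|exact: ler_wpM2l].
  have T2 : eta ^+ 2 / 4 * b ^+ 2 <= eta ^+ 2 / 4 * (C * a) ^+ 2.
    by rewrite ler_wpM2l ?divr_ge0 ?exprn_ge0// lerXn2r ?nnegrE// (le_trans b0).
  have T3 : `|alpha| * (a * y) <= `|alpha| * (a * ((1 + K) * (kappa * (C * a)))).
    by apply: ler_wpM2l => //; exact: (ler_wpM2l a0 yle).
  move=> dle.
  have T4 : delta * a ^+ 2 <= (2 * s + rho - (2 * s * ep + eta) * C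
     - eta ^+ 2 / 4 * C ^+ 2 - `|alpha| * (1 + K) * kappa * C) * a ^+ 2.
    by rewrite ler_wpM2r// sqr_ge0.
  by move: T1 T2 T3 T4; rewrite -/ep; lra.
have cV : {within `[0, t], continuous V}.
  have cz : {within `[0, t], continuous (fun u => l2norm (expgen M.+2 s (w u)))}.
    apply: l2norm_within_continuous => // u u0.
    by apply: L2_continuous_expgen => //; exact: cw.
  by move=> u; apply: cvgM; exact: cz.
have := exp_decay t0 cV (fun u u0 => (HdV u u0).1) (fun u u0 => (HdV u u0).2).
rewrite (_ : - (2 * delta) * t = (- delta * t) + (- delta * t)); last by ring.
rewrite expRD /V -expr2 -exprMn ler_sqr// nnegrE ?mulr_ge0 ?expR_ge0 ?l2norm_ge0//.
Qed.

End Stability.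

Unset Implicit Arguments.
Set Strict Implicit.
Set Printing Implicit Defensive.

Theorem theorem10 (R : realType) (rho alpha beta gamma c2 : R)
    (halpha : alpha != 0) (hbeta : beta != 0)
    (hgamma : forall n : nat, gamma != - (n%:R * pi) ^+ 2)
    (hgamma0 : 0 < gamma)
    (hc2 : 0 < c2)
    (hstab : c2 + rho > `|alpha * beta| / gamma *
       (1 + Num.sqrt (c2 * pi / 8)
            * Num.sqrt (erfi (Num.sqrt (c2 / 2)))
            * Num.sqrt (erf (Num.sqrt (c2 / 2)))) ^+ 2) :
  exponentially_stable
    (fun w v => is_solution rho alpha beta gamma (control c2 w) w v).
Proof.
have k0 : 0 <= `|beta| / gamma by rewrite divr_ge0// ltW.
have s0 : 0 <= c2 / 2 by rewrite divr_ge0// ltW.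
have K0 := hsbound_ge0 s0.
rewrite hsboundE// normrM -(mulrA `|alpha|) in hstab.
have [M [delta [te d0 dle]]] := small_truncation hc2 k0 hstab.
have C0 : 0 <= inverse_bound (c2 / 2) M.
  by apply: divr_ge0; [rewrite addr_ge0|rewrite subr_ge0 ltW].
pose B := (1 + `|beta| / gamma) * (inverse_bound (c2 / 2) M * (1 + hsbound (c2 / 2))).
have B0 : 0 <= B by apply: mulr_ge0; [|apply: mulr_ge0 C0 _]; exact: addr_ge0.
exists (1 + B), delta; split => //; first by rewrite lerDl.
move=> w v sol t t0.
have := energy_decay hgamma0 hc2 te dle sol t0.
have [Lw _ _ ev] := sol.
have [vx [vxx [Hv eqv vx0 vx1]]] := ev t t0.
have Lwt := Lw t t0; have Lw0 := Lw 0 (lexx _).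
have vle := elliptic_bound hgamma0 Lwt Hv eqv vx0 vx1.
have wle := inverse_norm s0 te Lwt.
have Tw := expgen_norm M.+1 (c2 / 2) Lw0; rewrite (ger0_norm s0) in Tw.
move=> fle.
apply: (@le_trans _ _ ((1 + `|beta| / gamma) * l2norm (w t))).
  by rewrite mulrDl mul1r lerD2l.
apply: (@le_trans _ _ (B * expR (- delta * t) * l2norm (w 0))); last first.
  by rewrite ler_wpM2r ?l2norm_ge0// ler_wpM2r ?expR_ge0// lerDr.
rewrite (_ : B * _ * _ = (1 + `|beta| / gamma) * (inverse_bound (c2 / 2) M *
  (expR (- delta * t) * ((1 + hsbound (c2 / 2)) * l2norm (w 0))))); last first.
  by rewrite /B; ring.
apply: ler_wpM2l; first exact: addr_ge0.
apply: le_trans wle _; apply: ler_wpM2l => //.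
by apply: le_trans fle _; apply: ler_wpM2l => //; exact: expR_ge0.
Qed.
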